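(* Let $\lambda$ and $\mu$ be strict partitions, let $l=l(\lambda)$ and $m=l(\mu)$ be their lengths, and put $s=m$ if $l+m$ is even and $s=m+1$ if $l+m$ is odd. Then $$Q_{\lambda/\mu}=\operatorname{Pf}\begin{pmatrix}A&B\\-{}^tB&O\end{pmatrix},$$ where $O$ is the $s\times s$ zero matrix and $$A=\Bigl(Q_{(\lambda_i,\lambda_j,\mu_1,\dots,\mu_m)/\mu}\Bigr)_{1\le i,j\le l},\qquad B=\Bigl(Q_{(\lambda_i,\mu_1,\dots,\widehat{\mu_j},\dots,\mu_s)/\mu}\Bigr)_{1\le i\le l,\ 1\le j\le s}.$$ Here $\widehat{\mu_j}$ means that $\mu_j$ is removed from the sequence.
   Context: A partition $\lambda=(\lambda_1,\lambda_2,\dots)$ is a weakly decreasing sequence of nonnegative integers with finitely many nonzero entries; its length $l(\lambda)$ is the number of nonzero entries, and it is strict if $\lambda_1>\lambda_2>\dots>\lambda_{l(\lambda)}$. In particular $\mu_{m+1}=0$ when $m=l(\mu)$. Schur $Q$-functions (Macdonald, Symmetric Functions and Hall Polynomials, III.8): define $q_n$ by $\sum_{n\ge0}q_nz^n=\prod_i\frac{1+x_iz}{1-x_iz}$; $Q_{(n)}=q_n$ for $n\ge 0$ (so $Q_{(0)}=1$); $Q_{(a,b)}=q_aq_b+2\sum_{i=1}^b(-1)^iq_{a+i}q_{b-i}$ for $a>b\ge 0$. For a strict partition $\lambda$, $Q_\lambda=\operatorname{Pf}\bigl(Q_{(\lambda_i,\lambda_j)}\bigr)_{1\le i,j\le N}$,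 where $N$ is $l(\lambda)$ or $l(\lambda)+1$, whichever is even (with $\lambda_{l(\lambda)+1}=0$), under the sign conventions below. The skew $Q$-functions $Q_{\lambda/\mu}$ for strict partitions $\lambda,\mu$ are determined by $Q_\lambda(x,y)=\sum_\mu Q_{\lambda/\mu}(x)Q_\mu(y)$, where $\mu$ runs over strict partitions. One has $Q_{\lambda/\emptyset}=Q_\lambda$, $Q_{\mu/\mu}=1$, and $Q_{\lambda/\mu}=0$ unless $\lambda_i\ge\mu_i$ for all $i$. Conventions: $Q_{(a,b)}=-Q_{(b,a)}$, $Q_{(a,0)}=-Q_{(0,a)}=Q_{(a)}$ for positive integers $a,b$; $Q_{(0,0)}=0$; and $Q_{(a)}=0$ for $a<0$. For sequences $\alpha=(\alpha_1,\dots,\alpha_N)$ and $\beta=(\beta_1,\dots,\beta_M)$ of nonnegative integers, define the $N\times M$ matrices $$S^\alpha_\beta=\bigl(Q_{(\alpha_i,\beta_j)}\bigr)_{1\le i\le N,1\le j\le M},\qquad T^\alpha_\beta=\bigl(Q_{(\alpha_i-\beta_{M+1-j})}\bigr)_{1\le i\le N,1\le j\le M}.$$ Extended notation: for a nonnegative integer sequence $\alpha$ of length $N$ (not necessarily decreasing, possibly with repeated entries) and a strict partition $\mu=(\mu_1,\dots,\mu_m)$ with $m=l(\mu)$, put $\mu^0=(\mu_1,\dots,\mu_m,0)$ and define $$Q_{\alpha/\mu}=\begin{cases}\operatorname{Pf}\begin{pmatrix}S^\alpha_\alpha&T^\alpha_\mu\\-{}^tT^\alpha_\mu&O\end{pmatrix}&\text{if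 }N+m\text{ is even},\\[2ex]\operatorname{Pf}\begin{pmatrix}S^\alpha_\alpha&T^\alpha_{\mu^0}\\-{}^tT^\alpha_{\mu^0}&O\end{pmatrix}&\text{if }N+m\text{ is odd}.\end{cases}$$ (By the Józefiak–Pragacz formula, this agrees with the skew $Q$-function $Q_{\lambda/\mu}$ when $\alpha=(\lambda_1,\dots,\lambda_{l(\lambda)})$ for a strict partition $\lambda$; it is alternating in the entries of $\alpha$.) The Pfaffian of a $2N\times2N$ skew-symmetric matrix $A=(a_{ij})$ is $\operatorname{Pf}A=\sum_{\pi}\operatorname{sgn}(\pi)\,a_{\pi(1),\pi(2)}\cdots a_{\pi(2N-1),\pi(2N)}$, summed over $\pi\in S_{2N}$ with $\pi(1)<\pi(3)<\dots<\pi(2N-1)$ and $\pi(2i-1)<\pi(2i)$ for $1\le i\le N$; the Pfaffian of the $0\times 0$ matrix is $1$. ${}^tB$ denotes the transpose of $B$. *)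

(* Defs.v *)
From HB Require Import structures.
From Stdlib Require Import ClassicalEpsilon.
From mathcomp Require Import all_boot all_order all_algebra all_fingroup.
From mathcomp Require Import mpoly.

Set Implicit Arguments.
Unset Strict Implicit.
Unset Printing Implicit Defensive.

Import GRing.Theory.
Local Open Scope ring_scope.

(* A symmetric function is handled through its images in the polynomial rings
   [{mpoly int[n]}], for all numbers [n] of variables: an identity between
   symmetric functions is an identity between these images for every [n]. *)

(* A partition is the sequence of its nonzero entries, so that its length is
   the [size] of the sequence. *)
Definition strict_partition (mu : seq nat) : bool :=
  sorted gtn mu && (0%N \notin mu).

(* Here [ordS i] is [i + 1] for even [i], and with positions counted from 0 the
   pairs pi(2k-1), pi(2k) are the [pi i], [pi (ordS i)] with [i] even.
   The definition is only meaningful for even [n]. *)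
Definition pfaffian_perm (n : nat) (pi : 'S_n) : bool :=
  [forall i : 'I_n, ~~ odd i ==> (pi i < pi (ordS i))%N] &&
  [forall i : 'I_n, forall j : 'I_n,
     [&& ~~ odd i, ~~ odd j & (i < j)%N] ==> (pi i < pi j)%N].

Definition Pf (R : comNzRingType) (n : nat) (A : 'M[R]_n) : R :=
  \sum_(pi : 'S_n | pfaffian_perm pi)
    (-1) ^+ odd_perm pi * \prod_(i < n | ~~ odd i) A (pi i) (pi (ordS i)).

(* The coefficient of z^k in prod_i (1 + x_i z) / (1 - x_i z); the geometric
   series of x_i z may be truncated after its term of degree k
   (see [qfun_generating]). *)
Definition qfun (n k : nat) : {mpoly int[n]} :=
  (\prod_(i < n) ((1 + ('X_i : {mpoly int[n]})%:P * 'X)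
                  * \sum_(j < k.+1) ('X_i ^+ j)%:P * 'X^j))`_k.

Definition Q1 (n : nat) (a : int) : {mpoly int[n]} :=
  if a is Posz k then qfun n k else 0.

Definition Q2_gt (n a b : nat) : {mpoly int[n]} :=
  qfun n a * qfun n b
  + 2 * \sum_(1 <= i < b.+1) (-1) ^+ i * qfun n (a + i) * qfun n (b - i).

Definition Q2 (n a b : nat) : {mpoly int[n]} :=
  if (b < a)%N then Q2_gt n a b
  else if (a < b)%N then - Q2_gt n b a
  else 0.

Definition Smx (n : nat) (al be : seq nat) :
    'M[{mpoly int[n]}]_(size al, size be) :=
  \matrix_(i < size al, j < size be) Q2 n (nth 0%N al i) (nth 0%N be j).

Definition Tmx (n : nat) (al be : seq nat) :
    'M[{mpoly int[n]}]_(size al, size be) :=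
  \matrix_(i < size al, j < size be)
    Q1 n ((nth 0%N al i)%:Z - (nth 0%N be (rev_ord j))%:Z).

Definition pad (b : bool) (s : seq nat) : seq nat :=
  if b then rcons s 0%N else s.

Definition Qfun (n : nat) (la : seq nat) : {mpoly int[n]} :=
  let la' := pad (odd (size la)) la in Pf (Smx n la' la').

(* The embeddings of the polynomials in x and in y into those in (x, y). *)
Definition in_x (n p : nat) (f : {mpoly int[n]}) : {mpoly int[n + p]} :=
  comp_mpoly [tuple 'X_(lshift p i) | i < n] f.

Definition in_y (n p : nat) (g : {mpoly int[p]}) : {mpoly int[n + p]} :=
  comp_mpoly [tuple 'X_(rshift n i) | i < p] g.

(* [F mu n] stands for Q_(la/mu)(x_1, ..., x_n). All but finitely many
   terms of the sum over strict partitions vanish. *)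
Definition skewQ_spec (la : seq nat)
    (F : seq nat -> forall n : nat, {mpoly int[n]}) : Prop :=
  exists s : seq (seq nat),
    [/\ uniq s,
        all strict_partition s,
        forall mu, strict_partition mu -> mu \notin s -> forall n, F mu n = 0
      & forall n p, Qfun (n + p) la =
          \sum_(mu <- s) in_x p (F mu n) * in_y n (Qfun p mu)].

(* The family satisfying [skewQ_spec la] is unique on strict partitions,
   because the Q_mu are linearly independent. *)
Definition skewQ (la mu : seq nat) (n : nat) : {mpoly int[n]} :=
  epsilon (inhabits (fun (_ : seq nat) (k : nat) => 0 : {mpoly int[k]}))
    (skewQ_spec la) mu n.

Definition Qext (n : nat) (al mu : seq nat) : {mpoly int[n]} :=
  let be := pad (odd (size al + size mu)) mu in
  Pf (block_mx (Smx n al al) (Tmx n al be) (- (Tmx n al be)^T) 0).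

Definition omit_nth (j : nat) (s : seq nat) : seq nat :=
  take j s ++ drop j.+1 s.

(* Sanity check of [qfun]: modulo z^N, the product of sum_k q_k z^k by
   prod_i (1 - x_i z) is prod_i (1 + x_i z). *)
Lemma qfun_generating (n N : nat) :
  take_poly N ((\poly_(k < N) qfun n k)
               * \prod_(i < n) (1 - ('X_i : {mpoly int[n]})%:P * 'X))
  = take_poly N (\prod_(i < n) (1 + ('X_i : {mpoly int[n]})%:P * 'X)).
Proof.
pose R : comNzRingType := {mpoly int[n]}.
pose cong M (p q : {poly R}) := forall i, (i < M)%N -> p`_i = q`_i.
have congM M p1 p2 q1 q2 :
    cong M p1 p2 -> cong M q1 q2 -> cong M (p1 * q1) (p2 * q2).
  move=> hp hq i hi; rewrite !coefM; apply: eq_bigr => j _.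
  rewrite hp ?hq //; first exact: leq_ltn_trans (leq_subr _ _) hi.
  by apply: leq_ltn_trans hi; rewrite -ltnS.
have cong_prod M (p q : 'I_n -> {poly R}) : (forall i, cong M (p i) (q i)) ->
    cong M (\prod_(i < n) p i) (\prod_(i < n) q i).
  by move=> h; elim/big_rec2: _ => // i a b _; apply: congM.
pose P K := \prod_(i < n) ((1 + ('X_i : R)%:P * 'X)
                           * \sum_(j < K) (('X_i : R) ^+ j)%:P * 'X^j).
have geomE (x : R) K : \sum_(j < K) (x ^+ j)%:P * 'X^j = \poly_(j < K) x ^+ j.
  by rewrite poly_def; apply: eq_bigr => j _; rewrite mul_polyC.
have congP k : (k < N)%N -> (P k.+1)`_k = (P N)`_k.
  move=> hk; apply: (cong_prod k.+1) => // i; apply: congM => // j hj.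
  by rewrite !geomE !coef_poly hj (leq_trans hj hk).
have congQ : cong N (\poly_(k < N) qfun n k) (P N).
  by move=> k hk; rewrite coef_poly hk -congP.
apply/polyP => k; rewrite !coef_take_poly; case: ifP => // hk.
rewrite (congM N _ (P N) _ _ congQ (fun _ _ => erefl)) //.
rewrite /P -big_split /=; apply: (cong_prod N) => // i j hj.
rewrite -mulrA -[RHS](congr1 (fun p : {poly R} => p`_j) (mulr1 _)).
apply: (congM N) => // {}j {}hj.
have ->: \sum_(j0 < N) (('X_i : R) ^+ j0)%:P * 'X^j0
         = \sum_(j0 < N) (('X_i : R)%:P * 'X) ^+ j0.
  by apply: eq_bigr => j0 _; rewrite exprMn rmorphXn.
rewrite mulrC -opprB mulNr -subrX1 opprB coefB exprMn -rmorphXn /=.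
by rewrite mul_polyC coefZ coefXn (ltn_eqF hj) mulr0 subr0.
Qed.

(* Main.v *)
Require Import Defs.
From Stdlib Require Import ClassicalEpsilon.
From mathcomp Require Import all_boot all_order all_algebra all_fingroup.
From mathcomp Require Import mpoly ring zify.

Set Implicit Arguments.
Unset Strict Implicit.
Unset Printing Implicit Defensive.
Import GRing.Theory.
Local Open Scope ring_scope.

(** The theorem is an instance of Sylvester's identity for Pfaffians.  Put
    [mus = (mu_1, ..., mu_s)] and let [X] be the skew-symmetric matrix with rows
    indexed by the parts of [la], the parts of [mus] and the columns of the block
    [T] of [mus].  The Pfaffian of [X] on the last two families is
    [Q_(mu/mu) = 1], so the Pfaffian of [X] on any larger index set is the
    Pfaffian of the matrix of the Pfaffians obtained by adding two indices to
    these families ([pf_sylvester]).  To describe the Pfaffian of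
    [la] and the columns, in which the parts of [mus] are absent, one adjoins for
    every part of [mus] an extra index paired with this part only: adding it to a
    word amounts to deleting the part.  This gives [pf_dual_sylvester], whose
    matrix is the one of the theorem: adding two parts of [la] gives [A], adding
    a part of [la] and an extra index gives [B], and adding two extra indices
    gives zero.  When [l + m] is odd, [mus] ends with a zero; the part [0] and the
    column of [0] have equal entries outside of their own pair, so they cancel in
    the entries of [A] ([pf_bordered_pair0]).

    It remains to identify [skewQ], which is defined by the expansion of
    [Q_la(x, y)], with the Pfaffian [Qext].  That [Qext] satisfies the expansion
    is the formula of Jozefiak and Pragacz ([qskew_expansion]): the generating
    series show that the matrix of the [Q_(a,b)(x, y)] is
    [S(x) + T(x) S(y) T(x)^t], and the Pfaffian of such a sum is expanded by the
    minor summation formula ([pf_minor_sum]).  Uniqueness is the linear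
    independence of the [Q_mu] ([qpf_independent]), which follows from the
    same expansion by separating one variable.

    Pfaffians are handled as functions [pf a s] of a form [a] and a word [s],
    defined by expansion along the first letter ([pf_cons]); [Pf_pf] identifies
    them with the sums over permutations. *)

(** * Expansion of a Pfaffian along its first row *)

(** The permutations sending [i] to [j] are the [lift_perm i j s]; the inverse
    bijection deletes [i] from the domain and [j] from the range. *)
Lemma sum_lift_perm (R : nmodType) n (i j : 'I_n.+1) (P : pred 'S_n.+1)
    (F : 'S_n.+1 -> R) :
  \sum_(s : 'S_n.+1 | P s && (s i == j)) F s =
  \sum_(s : 'S_n | P (lift_perm i j s)) F (lift_perm i j s).
Proof.
rewrite (reindex (lift_perm i j)) /=.
  by apply: eq_bigl => s; rewrite lift_perm_id eqxx andbT.
pose ulsf (s : 'S_n.+1) k := odflt k (unlift (s i) (s (lift i k))).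
have ulsfK (s : 'S_n.+1) k : lift (s i) (ulsf s k) = s (lift i k).
  rewrite /ulsf; have := neq_lift i k.
  by rewrite -(can_eq (permK s)) => /unlift_some[] ? ? ->.
have inj_ulsf (s : 'S_n.+1) : injective (ulsf s).
  by move=> k l /(congr1 (lift (s i))); rewrite !ulsfK => /perm_inj/lift_inj.
exists (fun s => perm (@inj_ulsf s)) => [s _ | s].
  by apply/permP=> k; rewrite permE /ulsf lift_perm_lift lift_perm_id liftK.
case/andP=> _ /eqP si; apply/permP=> k.
case: (unliftP i k) => [k'|] ->; rewrite ?lift_perm_id //.
by rewrite lift_perm_lift -si permE ulsfK.
Qed.

(** The value [0] cannot sit in an odd position, being smaller than the entry
    before it, nor in a positive even one, being smaller than the first entry. *)
Lemma pfaffian_perm0 n (pi : 'S_n.+2) :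
  ~~ odd n -> pfaffian_perm pi -> pi ord0 = ord0.
Proof.
move=> n_even /andP[/forallP hpair /forallP hfirst].
pose z := (pi^-1)%g ord0.
have piz : pi z = ord0 by rewrite permKV.
case z_odd: (odd z).
  have z_gt0 : (0 < z)%N by case: (z : nat) z_odd.
  have hz : (z.-1 < n.+2)%N by apply: leq_ltn_trans (leq_pred _) (ltn_ord z).
  have := hpair (Ordinal hz) => /implyP /=.
  have -> : ordS (Ordinal hz) = z.
    by apply: val_inj; rewrite /= prednK // modn_small.
  by rewrite piz -oddS prednK // z_odd => /(_ isT).
have [z0|z_gt0] := posnP z.
  by rewrite -[RHS]piz; congr (pi _); apply: val_inj.
have /forallP/(_ z)/implyP := hfirst ord0.
by rewrite /= z_odd z_gt0 piz => /(_ isT).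
Qed.

(** Such a permutation matches [0] with [j] and keeps the rest of the matching;
    the parity of [n] is what makes [ordS] commute with the two lifts on even
    positions, as it then never wraps around. *)
Lemma pfaffian_perm_lift n (j : 'I_n.+1) (r : 'S_n) : ~~ odd n ->
  pfaffian_perm (lift_perm ord0 ord0 (lift_perm ord0 j r)) = pfaffian_perm r.
Proof.
move=> n_even; set pi := lift_perm _ _ _.
have pi0 : pi ord0 = ord0 by rewrite /pi lift_perm_id.
have pi1 : pi (lift ord0 ord0) = lift ord0 j.
  by rewrite /pi lift_perm_lift lift_perm_id.
have piS k : pi (lift ord0 (lift ord0 k)) = lift ord0 (lift j (r k)).
  by rewrite /pi !lift_perm_lift.
have ordS0 : ordS (ord0 : 'I_n.+2) = lift ord0 ord0.
  by apply: val_inj; rewrite /= modn_small.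
have ordSS (k : 'I_n) : ~~ odd k ->
    ordS (lift ord0 (lift ord0 k) : 'I_n.+2) = lift ord0 (lift ord0 (ordS k)).
  move=> k_even; have hk : (k.+1 < n)%N.
    rewrite ltn_neqAle ltn_ord andbT.
    by apply: contra n_even => /eqP <-; rewrite oddS.
  by apply: val_inj; rewrite /= /bump !add1n !modn_small // !ltnS.
have lt_pi (k l : 'I_n) : (pi (lift ord0 (lift ord0 k)) < pi (lift ord0 (lift ord0 l)))%N
    = (r k < r l)%N.
  rewrite !piS /= /bump !add1n ltnS.
  by rewrite ltnNge -[(_ + r l <= _)%N]/(bump j (r l) <= bump j (r k))%N leq_bump2 -ltnNge.
congr (_ && _); apply/forallP/forallP => h.
- move=> i; have := h (lift ord0 (lift ord0 i)) => /implyP; rewrite /= negbK => {}h.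
  apply/implyP => i_even; move: (h i_even).
  by rewrite ordSS // lt_pi.
- move=> i; apply/implyP => i_even.
  case: (unliftP ord0 i) i_even => [i1|] ->; last by rewrite ordS0 pi0 pi1.
  case: (unliftP ord0 i1) => [k|] ->; last by [].
  rewrite /= negbK => k_even; rewrite ordSS // lt_pi.
  by have /implyP/(_ k_even) := h k.
- move=> k; apply/forallP => l; apply/implyP => /and3P[hk hl kl].
  have /forallP/(_ (lift ord0 (lift ord0 l)))/implyP := h (lift ord0 (lift ord0 k)).
  by rewrite lt_pi; apply; rewrite /= !negbK hk hl.
- move=> i; apply/forallP => l; apply/implyP => /and3P[].
  case: (unliftP ord0 l) => [l1|] -> //.
  case: (unliftP ord0 l1) => [l2|] -> //.
  case: (unliftP ord0 i) => [i1|] -> //; last by rewrite pi0 piS.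
  case: (unliftP ord0 i1) => [i2|] -> //.
  rewrite lt_pi /= !negbK => hi hl il.
  have /forallP/(_ l2)/implyP := h i2; apply.
  by rewrite hi hl.
Qed.

(** The matchings are sorted by the partner of [0]; with [Pf0] this makes every
    statement about [Pf] accessible to induction. *)
Lemma Pf_expand (R : comNzRingType) n (A : 'M[R]_n.+2) : ~~ odd n ->
  Pf A = \sum_(j < n.+1) (-1) ^+ j * A ord0 (lift ord0 j)
           * Pf (\matrix_(k, l) A (lift ord0 (lift j k)) (lift ord0 (lift j l))).
Proof.
move=> n_even; rewrite /Pf.
rewrite (eq_bigl (fun pi : 'S_n.+2 => pfaffian_perm pi && (pi ord0 == ord0))); last first.
  move=> pi; case hpi: (pfaffian_perm pi) => //=.
  by rewrite pfaffian_perm0 ?eqxx.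
rewrite sum_lift_perm (partition_big (fun s : 'S_n.+1 => s ord0) xpredT) //=.
apply: eq_bigr => j _; rewrite sum_lift_perm big_distrr /=.
apply: eq_big => [r|r]; first by rewrite pfaffian_perm_lift.
move=> _; rewrite !odd_lift_perm /= signr_addb signr_odd -!mulrA; congr (_ * _).
rewrite mulrCA; congr (_ * _).
rewrite big_mkcond big_ord_recl /= lift_perm_id.
have -> : ordS (ord0 : 'I_n.+2) = lift ord0 ord0.
  by apply: val_inj; rewrite /= modn_small.
rewrite lift_perm_lift lift_perm_id; congr (_ * _).
rewrite big_ord_recl /= mul1r [RHS]big_mkcond; apply: eq_bigr => k _ /=.
rewrite negbK; case: ifP => // k_even; rewrite mxE !lift_perm_lift.
have hk : (k.+1 < n)%N.
  rewrite ltn_neqAle ltn_ord andbT.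
  by apply: contra n_even => /eqP <-; rewrite oddS k_even.
have -> : ordS (lift ord0 (lift ord0 k) : 'I_n.+2) = lift ord0 (lift ord0 (ordS k)).
  by apply: val_inj; rewrite /= /bump !add1n !modn_small // !ltnS.
by rewrite !lift_perm_lift.
Qed.

Lemma Pf0 (R : comNzRingType) (A : 'M[R]_0) : Pf A = 1.
Proof.
rewrite /Pf (bigD1 (1%g : 'S_0)) /=.
  rewrite odd_perm1 expr0 mul1r big1 => [|[]//]; rewrite big1 ?addr0 // => pi.
  by case/andP=> _ /eqP[]; apply/permP => -[].
by apply/andP; split; apply/forallP => -[].
Qed.

(** * Pfaffians of words *)

Section AltSum.
Variables (R : comNzRingType) (T : eqType).
Implicit Types (s t u v : seq T) (g : T -> seq T -> R).

(** The sum of [(-1) ^+ i * g (entry i of s) (s without entry i)], as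
    [alt_sumE] says.  The recursive form lets identities between iterated
    expansions be proved by structural induction, without indices. *)
Fixpoint alt_sum g s : R :=
  if s is x :: s' then g x s' - alt_sum (fun y t => g y (x :: t)) s' else 0.

Lemma eq_alt_sum g g' s :
  (forall x t, perm_eq (x :: t) s -> g x t = g' x t) ->
  alt_sum g s = alt_sum g' s.
Proof.
elim: s g g' => //= x s IH g g' h; rewrite h //; congr (_ - _).
apply: IH => y t hy; apply: h.
by rewrite (perm_catCA [:: y] [:: x] t) /= perm_cons.
Qed.

Lemma alt_sum0 g s : (forall x t, perm_eq (x :: t) s -> g x t = 0) ->
  alt_sum g s = 0.
Proof.
move/eq_alt_sum ->; elim: s => //= x s IH.
by rewrite IH subr0.
Qed.

Lemma alt_sumD g g' s :
  alt_sum (fun x t => g x t + g' x t) s = alt_sum g s + alt_sum g' s.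
Proof. elim: s g g' => [|x s IH] g g' /=; first by ring. by rewrite IH; ring. Qed.

Lemma alt_sumZ c g s : alt_sum (fun x t => c * g x t) s = c * alt_sum g s.
Proof. elim: s g => [|x s IH] g /=; first by ring. by rewrite IH; ring. Qed.

Lemma alt_sumN g s : alt_sum (fun x t => - g x t) s = - alt_sum g s.
Proof. elim: s g => [|x s IH] g /=; first by ring. by rewrite IH; ring. Qed.

Lemma alt_sumB g g' s :
  alt_sum (fun x t => g x t - g' x t) s = alt_sum g s - alt_sum g' s.
Proof. by rewrite alt_sumD alt_sumN. Qed.

Lemma alt_sumZr c g s : alt_sum (fun x t => g x t * c) s = alt_sum g s * c.
Proof. by rewrite mulrC -alt_sumZ; apply: eq_alt_sum => x t _; rewrite mulrC. Qed.

Lemma alt_sum_bigE (I : Type) (r : seq I) (F : I -> T -> seq T -> R) s :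
  alt_sum (fun x t => \sum_(i <- r) F i x t) s = \sum_(i <- r) alt_sum (F i) s.
Proof.
elim: r => [|i r IH].
  by rewrite big_nil alt_sum0 // => x t _; rewrite big_nil.
rewrite big_cons -IH -alt_sumD; apply: eq_alt_sum => x t _.
by rewrite big_cons.
Qed.

Lemma alt_sum_cat g u v :
  alt_sum g (u ++ v) = alt_sum (fun x t => g x (t ++ v)) u
    + (-1) ^+ size u * alt_sum (fun x t => g x (u ++ t)) v.
Proof.
elim: u g => [|x u IH] g /=; first by rewrite expr0; ring.
by rewrite IH exprS; ring.
Qed.

Lemma exchange_alt_sum (f : T -> seq T -> T -> seq T -> R) u v :
  alt_sum (fun x t => alt_sum (f x t) v) u =
  alt_sum (fun y r => alt_sum (fun x t => f x t y r) u) v.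
Proof.
elim: u f => [|x u IH] f /=; first by rewrite alt_sum0.
by rewrite IH alt_sumB.
Qed.

(** Deleting two entries in either order leaves the same word, but the position
    of one of them is shifted by one. *)
Lemma alt_sum2_anti (f : T -> T -> seq T -> R) s :
  alt_sum (fun x t => alt_sum (f x) t) s =
  - alt_sum (fun x t => alt_sum (fun y r => f y x r) t) s.
Proof.
elim: s f => [|x s IH] f /=; first by ring.
rewrite !alt_sumB [alt_sum (fun _ _ => alt_sum _ _) s]IH; ring.
Qed.

Lemma alt_sumE x0 g s :
  alt_sum g s = \sum_(i < size s) (-1) ^+ i * g (nth x0 s i) (take i s ++ drop i.+1 s).
Proof.
elim: s g => [|x s IH] g /=; first by rewrite big_ord0.
rewrite big_ord_recl IH /= expr0 mul1r /= drop0; congr (_ + _).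
by rewrite -sumrN; apply: eq_bigr => i _; rewrite /= exprS; ring.
Qed.

End AltSum.

Lemma alt_sum_mapE (R : comNzRingType) (S T : eqType) (h : S -> T)
    (g : T -> seq T -> R) s :
  alt_sum g (map h s) = alt_sum (fun x t => g (h x) (map h t)) s.
Proof. by elim: s g => //= x s IH g; rewrite IH. Qed.

Lemma rmorph_alt_sum (R S : comNzRingType) (T : eqType) (phi : {rmorphism R -> S})
    (g : T -> seq T -> R) s :
  phi (alt_sum g s) = alt_sum (fun x t => phi (g x t)) s.
Proof. by elim: s g => [|x s IH] g /=; rewrite ?rmorph0 // rmorphB IH. Qed.

Section PfaffianOfWord.
Variables (R : comNzRingType) (T : eqType) (a : T -> T -> R).
Implicit Types (s t u v w : seq T).

(** Expansion along the first entry removes two entries at a time, so the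
    recursion is on a bound [k] for the size; see [pf_fuelE] and [pf_cons]. *)
Fixpoint pf_fuel k s : R :=
  if s isn't x :: s' then 1 else
  if k isn't k'.+1 then 0 else alt_sum (fun y t => a x y * pf_fuel k' t) s'.

(** The Pfaffian of the matrix of the values of [a] on the entries of [s]
    (see [Pf_pf]). *)
Definition pf s := pf_fuel (size s) s.

Lemma pf_fuelE k s : (size s <= k)%N -> pf_fuel k s = pf s.
Proof.
rewrite /pf; move: {2 4}(size s) (leqnn (size s)) => l hl hk.
elim: k l s hl hk => [|k IH] [|l] [|x s] //=; rewrite !ltnS => hl hk.
apply: eq_alt_sum => y t /perm_size /= hs; congr (_ * _).
by apply: IH; rewrite ltnW // hs.
Qed.

Lemma pf_nil : pf [::] = 1. Proof. by []. Qed.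

Lemma pf_cons x s : pf (x :: s) = alt_sum (fun y t => a x y * pf t) s.
Proof.
rewrite {1}/pf /=; apply: eq_alt_sum => y t /perm_size /= hs; congr (_ * _).
by rewrite pf_fuelE // -hs.
Qed.

Lemma pf_odd s : odd (size s) -> pf s = 0.
Proof.
have [n] := ubnP (size s); elim: n s => // n IH [|x s] //= /ltnSE hn hs.
rewrite pf_cons alt_sum0 // => y t ht.
have e : size s = (size t).+1 by rewrite -(perm_size ht).
rewrite IH ?mulr0 //; first by rewrite -ltnS -e ltnW.
by move: hs; rewrite e /= negbK.
Qed.

(** Every perfect matching pairs two entries of the longer part [v]. *)
Lemma pf_isotropic u v : {in v &, forall x y, a x y = 0} ->
  (size u < size v)%N -> pf (u ++ v) = 0.
Proof.
have [n] := ubnP (size (u ++ v)); elim: n u v => // n IH [|x u] v /= /ltnSE hn hv uv.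
  case: v hv uv {hn} => // x v hv _; rewrite pf_cons alt_sum0 // => y t hy.
  by rewrite hv ?mul0r ?mem_head // inE -(perm_mem hy) mem_head orbT.
rewrite size_cat in hn.
rewrite pf_cons alt_sum_cat !alt_sum0 ?mulr0 ?addr0 // => y t ht;
  have /= e := perm_size ht; rewrite IH ?mulr0 ?size_cat //; try lia.
by move=> z w hz hw; apply: hv; rewrite -(perm_mem ht) inE ?hz ?hw orbT.
Qed.

End PfaffianOfWord.

Section AlternatingWord.
Variables (R : idomainType) (T : eqType) (a : T -> T -> R).
Hypothesis two_neq0 : (2 : R) != 0.
Hypothesis a_anti : forall x y, a x y = - a y x.
Implicit Types (s t u v w : seq T).

(** A Pfaffian with a repeated entry is shown to vanish through being its own
    opposite. *)
Lemma eq_opp_eq0 (x : R) : x = - x -> x = 0.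
Proof.
move=> e; apply/eqP; have /eqP : 2 * x = 0 by rewrite mulr2n mulrDl mul1r {2}e subrr.
by rewrite mulf_eq0 (negPf two_neq0).
Qed.

Lemma a_diag x : a x x = 0. Proof. exact: eq_opp_eq0. Qed.

(** Expanding along both letters gives the term [a x y * pf a s] and a double
    sum; the first changes sign under the exchange of [x] and [y] as [a] does,
    the second one by [alt_sum2_anti]. *)
Lemma pf_swap_head x y s : pf a (x :: y :: s) = - pf a (y :: x :: s).
Proof.
rewrite !pf_cons /= [a y x]a_anti.
have e (z w : T) : alt_sum (fun y0 t => a z y0 * pf a (w :: t)) s =
    alt_sum (fun y0 t => alt_sum (fun y1 r => a z y0 * (a w y1 * pf a r)) t) s.
  by apply: eq_alt_sum => c t _; rewrite pf_cons -alt_sumZ.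
rewrite !e alt_sum2_anti.
rewrite (eq_alt_sum (g' := fun y0 t => alt_sum (fun y1 r => a y y0 * (a x y1 * pf a r)) t)).
  by ring.
by move=> z t _; apply: eq_alt_sum => w r _; ring.
Qed.

Lemma pf_swap u x y v : pf a (u ++ x :: y :: v) = - pf a (u ++ y :: x :: v).
Proof.
have [n] := ubnP (size u); elim: n u v => // n IH [|z u] v /= /ltnSE hn.
  exact: pf_swap_head.
rewrite !pf_cons !alt_sum_cat /=.
rewrite [RHS]opprD; congr (_ + _).
  rewrite -alt_sumN; apply: eq_alt_sum => c t /perm_size /= ht.
  rewrite IH; first by rewrite mulrN.
  by move: hn; rewrite -ht => /ltnW.
rewrite -mulrN; congr (_ * _).
rewrite (eq_alt_sum (g' := fun c t => -1 * (a z c * pf a (u ++ y :: x :: t)))).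
  by rewrite alt_sumZ; ring.
by move=> c t _; rewrite IH //; ring.
Qed.

Lemma pf_move u x v w :
  pf a (u ++ x :: v ++ w) = (-1) ^+ size v * pf a (u ++ v ++ x :: w).
Proof.
elim: v u => [|y v IH] u /=; first by rewrite mul1r.
rewrite pf_swap -cat_rcons IH cat_rcons exprS; ring.
Qed.

Lemma pf_dup u x v w : pf a (u ++ x :: v ++ x :: w) = 0.
Proof.
rewrite pf_move; apply/eqP; rewrite mulf_eq0; apply/orP; right.
by rewrite catA; apply/eqP; apply: eq_opp_eq0; rewrite -pf_swap.
Qed.

Lemma pf_head_dup x s : x \in s -> pf a (x :: s) = 0.
Proof. by case/splitPr => u v; rewrite (pf_dup [::]). Qed.

(** Both sides expand to the same double sum over an entry of [u] and an entry
    of [v]; the sign is that of the skew-symmetry of [a]. *)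
Lemma pf_plucker u v :
  alt_sum (fun x t => pf a (x :: v) * pf a t) u =
  - alt_sum (fun y r => pf a (y :: u) * pf a r) v.
Proof.
transitivity (alt_sum (fun x t => alt_sum (fun y r => a x y * pf a r * pf a t) v) u).
  by apply: eq_alt_sum => x t _; rewrite pf_cons -alt_sumZr.
rewrite exchange_alt_sum -alt_sumN; apply: eq_alt_sum => y r _.
rewrite pf_cons -mulNr -alt_sumN -alt_sumZr; apply: eq_alt_sum => x t _.
rewrite [a y x]a_anti; ring.
Qed.

(** Sylvester's identity for Pfaffians (Knuth's overlapping Pfaffians): apply
    [pf_plucker] to [s ++ b] and [x :: b].  The terms that take an entry of [b]
    out of one word put it into a word that already contains it, so they
    vanish, and what is left is the expansion of the right-hand side along [x]. *)
Lemma pf_sylvester s b : pf a b = 1 ->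
  pf a (s ++ b) = pf (fun x y => pf a (x :: y :: b)) s.
Proof.
move=> b1; have [n] := ubnP (size s); elim: n s => // n IH [|x s] /= /ltnSE hn.
  by rewrite b1.
rewrite [RHS]pf_cons.
have := pf_plucker (s ++ b) (x :: b).
rewrite alt_sum_cat [X in _ + _ * X]alt_sum0; last first.
  move=> y t /perm_mem h; rewrite pf_head_dup ?mul0r //.
  by rewrite inE -h mem_head orbT.
rewrite mulr0 addr0 /= [X in _ - X]alt_sum0; last first.
  move=> y t /perm_mem h; rewrite pf_head_dup ?mul0r //.
  by rewrite mem_cat -h mem_head orbT.
rewrite subr0 b1 mulr1 => /(congr1 -%R); rewrite opprK => <-.
rewrite -alt_sumN; apply: eq_alt_sum => y t /perm_size /= ht.
by rewrite pf_swap_head mulNr opprK IH // ht ltnW.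
Qed.

(** Subtracting [p'] from [p] leaves an entry that pairs with [p'] only. *)
Lemma pf_cancel_pair u p p' v : a p p' = 1 ->
  {in u ++ v, forall x, a p x = a p' x} -> pf a (u ++ p :: p' :: v) = pf a (u ++ v).
Proof.
move=> app' h.
have head w : {in w, forall x, a p x = a p' x} -> pf a (p :: p' :: w) = pf a w.
  (* [pf a (p' :: p' :: w)] is zero and differs from [pf a (p :: p' :: w)] by the
     term of the pair of the first two letters only. *)
  move=> hw; rewrite -[LHS]subr0 -(pf_head_dup (mem_head p' w)) pf_cons [X in _ - X]pf_cons /=.
  rewrite app' a_diag.
  rewrite (eq_alt_sum (g' := fun y t => a p' y * pf a (p' :: t))) => [|y t hy]; first by ring.
  by rewrite hw // -(perm_mem hy) mem_head.
rewrite -(head (u ++ v)) //.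
rewrite (pf_move [:: p] p') (pf_move [::] p) /=.
by rewrite mulrCA !mulrA -expr2 sqrr_sign mul1r.
Qed.

End AlternatingWord.

(** * Sylvester's identity and its dual form *)

Section PfTransfer.
Variables (R : comNzRingType).

Lemma eq_pf (T : eqType) (a b : T -> T -> R) s :
  {in s &, forall x y, a x y = b x y} -> pf a s = pf b s.
Proof.
have [n] := ubnP (size s); elim: n s => // n IH [|x s] //= /ltnSE hn hab.
rewrite !pf_cons; apply: eq_alt_sum => y t ht.
have hs := perm_mem ht; have /= e := perm_size ht.
have hx z : z \in s -> z \in x :: s by rewrite inE orbC => ->.
have hy : y \in s by rewrite -hs mem_head.
rewrite hab ?mem_head ?hx // IH //; first lia.
by move=> z w hz hw; apply: hab; rewrite hx // -hs inE ?hz ?hw orbT.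
Qed.

Lemma pf_map (S T : eqType) (h : S -> T) (a : T -> T -> R) s :
  pf a (map h s) = pf (fun x y => a (h x) (h y)) s.
Proof.
have [n] := ubnP (size s); elim: n s => // n IH [|x s] //= /ltnSE hn.
rewrite !pf_cons alt_sum_mapE; apply: eq_alt_sum => y t /perm_size /= e.
by rewrite IH //; lia.
Qed.

Lemma rmorph_pf (S : comNzRingType) (phi : {rmorphism R -> S}) (T : eqType)
    (a : T -> T -> R) s :
  phi (pf a s) = pf (fun x y => phi (a x y)) s.
Proof.
have [n] := ubnP (size s); elim: n s => // n IH [|x s] /= /ltnSE hn.
  exact: rmorph1.
rewrite !pf_cons rmorph_alt_sum; apply: eq_alt_sum => y t /perm_size /= e.
by rewrite rmorphM IH //; lia.
Qed.

(** Both Pfaffians expand in the same way along the first row. *)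
Lemma Pf_pf (T : eqType) (a : T -> T -> R) x0 s n (A : 'M[R]_n) :
  size s = n -> ~~ odd n ->
  (forall i j, A i j = a (nth x0 s i) (nth x0 s j)) -> Pf A = pf a s.
Proof.
have [k] := ubnP n; elim: k n A s => // k IH [|[|n]] A [|x s] // hn.
  by move=> _ _ _; rewrite Pf0.
case=> hs /=; rewrite negbK => n_even hA.
rewrite Pf_expand // pf_cons (alt_sumE x0) hs; apply: eq_bigr => j _.
rewrite -mulrA hA /=; congr (_ * (_ * _)).
have hj := ltn_ord j.
have ht : size (take j s) = j by rewrite size_takel // hs ltnW.
apply: IH => //; first lia.
  by rewrite size_cat size_drop ht hs; lia.
have e (i : nat) : nth x0 (take j s ++ drop j.+1 s) i = nth x0 s (bump j i).
  rewrite nth_cat ht /bump; case: ltnP => h; first by rewrite nth_take.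
  by rewrite nth_drop; congr nth; lia.
by move=> i l; rewrite mxE hA !e.
Qed.

End PfTransfer.

Section MoreWords.
Variables (R : idomainType) (T : eqType) (a : T -> T -> R).
Hypothesis a_anti : forall x y, a x y = - a y x.
Implicit Types (s t u v w : seq T).

Lemma pf_pair_front u p p' v :
  pf a (u ++ p :: p' :: v) = pf a (p :: p' :: u ++ v).
Proof.
rewrite (pf_move a_anti [:: p] p') (pf_move a_anti [::] p) /=.
by rewrite mulrA -expr2 sqrr_sign mul1r.
Qed.

(** Every matching with a nonzero contribution pairs [p] with [p']. *)
Lemma pf_isolated_pair u p p' v : {in u ++ v, forall x, a p x = 0} ->
  pf a (u ++ p :: p' :: v) = a p p' * pf a (u ++ v).
Proof.
move=> h; rewrite pf_pair_front pf_cons /= alt_sum0 ?subr0 // => y t ht.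
by rewrite h ?mul0r // -(perm_mem ht) mem_head.
Qed.

Lemma pf_to_front u p v : pf a (u ++ p :: v) = (-1) ^+ size u * pf a (p :: u ++ v).
Proof.
by rewrite (pf_move a_anti [::] p u v) /= mulrA -expr2 sqrr_sign mul1r.
Qed.

Lemma pf_replace u p p' v : {in u ++ v, forall x, a p x = a p' x} ->
  pf a (u ++ p :: v) = pf a (u ++ p' :: v).
Proof.
move=> h; rewrite !pf_to_front; congr (_ * _); rewrite !pf_cons.
by apply: eq_alt_sum => y t ht; rewrite h // -(perm_mem ht) mem_head.
Qed.

Lemma pf_zero_entry p s : (1 < size s)%N -> p \in s ->
  {in s, forall x, a p x = 0} -> pf a s = 0.
Proof.
move=> s1 /splitPr[u v] h; rewrite pf_to_front pf_cons alt_sum0 ?mulr0 // => y t ht.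
rewrite h ?mul0r // mem_cat inE orbCA -mem_cat -(perm_mem ht) mem_head orbT //.
Qed.

(** The last letter can only be matched with the first one. *)
Lemma pf_ends p v p' : {in v, forall x, a p' x = 0} ->
  pf a (p :: v ++ [:: p']) = (-1) ^+ size v * a p p' * pf a v.
Proof.
move=> h; have := pf_move a_anti [::] p v [:: p']; rewrite /= => ->.
rewrite (pf_swap a_anti) pf_isolated_pair cats0 //.
by rewrite [a p p']a_anti; ring.
Qed.

End MoreWords.

Section DualSylvester.
Variables (R : idomainType) (T : eqType) (a : T -> T -> R).
Hypothesis two_neq0 : (2 : R) != 0.
Hypothesis a_anti : forall x y, a x y = - a y x.
Variables (al b c : seq T).
Hypothesis c_iso : {in c &, forall x y, a x y = 0}.
Hypothesis size_bc : size b = size c.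
Hypothesis pf_bc : pf a (b ++ c) = 1.

(** The entries of the right-hand side of [pf_dual_sylvester]: [inl x] stands
    for an entry [x] of [al], and [inr j] for the [j]-th entry of [b]. *)
Definition sylv_form (u v : T + nat) : R :=
  match u, v with
  | inl x, inl y => pf a [:: x, y & b ++ c]
  | inl x, inr j => pf a (x :: (take j b ++ drop j.+1 b) ++ c)
  | inr j, inl x => - pf a (x :: (take j b ++ drop j.+1 b) ++ c)
  | inr _, inr _ => 0
  end.

Local Notation T' := (T + (nat + nat))%type.
Local Notation pos j := (inr (inl j) : T').
Local Notation dag j := (inr (inr j) : T').

Variable x0 : T.
Definition undual (u : T') : T :=
  match u with inl x => x | inr (inl j) => nth x0 b j | _ => x0 end.

(** The alphabet is enlarged by the positions [pos j] of the entries of [b],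
    which keep equal values apart, and by letters [dag j], each paired with
    [pos j] only.  In a word, [dag j] has the effect of deleting the [j]-th
    entry of [b]; the value [(-1) ^+ j] absorbs the sign of that deletion. *)
Definition dual_form (u v : T') : R :=
  match u, v with
  | inr (inr i), inr (inl j) => (-1) ^+ i * (i == j)%:R
  | inr (inl j), inr (inr i) => - ((-1) ^+ i * (i == j)%:R)
  | inr (inr _), _ => 0
  | _, inr (inr _) => 0
  | _, _ => a (undual u) (undual v)
  end.

Lemma dual_form_anti u v : dual_form u v = - dual_form v u.
Proof. by case: u v => [x|[i|i]] [y|[j|j]] /=; rewrite ?oppr0 ?opprK. Qed.

Let no_dag (u : T') := if u is inr (inr _) then false else true.

Lemma pf_undual s : all no_dag s -> pf dual_form s = pf a (map undual s).
Proof.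
move=> /allP hs; rewrite pf_map; apply: eq_pf => u v /hs + /hs.
by case: u v => [x|[i|i]] [y|[j|j]].
Qed.

Let inc : seq T' := map inl c.
Let posb : seq T' := [seq pos j | j <- iota 0 (size b)].

Lemma map_undual_inl s : map undual (map inl s) = s.
Proof. by rewrite -map_comp map_id. Qed.

Lemma map_undual_posb : map undual posb = b.
Proof.
by rewrite -map_comp -[RHS](mkseq_nth x0).
Qed.

(** Moving [dag k] next to [pos k] costs [(-1) ^+ k], which the value of the
    form on this pair compensates. *)
Lemma pf_remove_dag w k rest :
  pos k \notin w -> pos k \notin rest ->
  pf dual_form (w ++ dag k :: [seq pos j | j <- iota 0 k] ++ pos k :: rest) =
  pf dual_form (w ++ [seq pos j | j <- iota 0 k] ++ rest).
Proof.
move=> hw hr; have A := dual_form_anti.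
rewrite (pf_move A) catA (pf_isolated_pair A) //=; last first.
  move=> u; rewrite !mem_cat -orbA => /or3P h.
  case: u h => [x|[i|i]] //= h; case: eqP => [e|]; last by rewrite mulr0.
  case: h => [h|/mapP[j]|h]; first by rewrite e h in hw.
    by rewrite mem_iota => hj [ej]; lia.
  by rewrite e h in hr.
by rewrite eqxx mulr1 size_map size_iota mulrA -expr2 sqrr_sign mul1r catA.
Qed.

Lemma posb_split j : (j < size b)%N ->
  posb = [seq pos i | i <- iota 0 j] ++ pos j :: [seq pos i | i <- iota j.+1 (size b - j.+1)].
Proof.
move=> hj; rewrite /posb -[in LHS](subnKC (ltnW hj)) iotaD map_cat; congr (_ ++ _).
by rewrite add0n -[(_ - j)%N](@prednK) ?subn_gt0 // /= subnS.
Qed.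

(** The last letter [dag k] deletes the last entry of [b] that is left, and so
    on down to the first. *)
Lemma pf_dual_cancel w k :
  all no_dag w -> (forall i, pos i \notin w) -> (k <= size b)%N ->
  pf dual_form (w ++ [seq dag j | j <- iota 0 k] ++ [seq pos j | j <- iota 0 k] ++ inc) =
  pf a (map undual w ++ c).
Proof.
move=> hw hw'; elim: k => [|k IH] hk.
  rewrite pf_undual.
    by rewrite map_cat map_undual_inl.
  by rewrite all_cat hw all_map; apply/allP.
rewrite -IH ?(ltnW hk) // -addn1 !iotaD !map_cat /= -!catA /= add0n catA.
rewrite pf_remove_dag -?catA //.
  rewrite mem_cat negb_or hw' /=; apply/mapP => -[] //.
by apply/mapP => -[].
Qed.

(** Write [al ++ c] as [al ++ dags ++ b ++ c] by [pf_dual_cancel] and apply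
    [pf_sylvester] with base [b ++ c].  A letter [dag j] in front of the base
    deletes an entry of [b], which gives the mixed entries; two of them leave
    [b] too short to be matched with the isotropic word [c], which gives the
    zero block. *)
Lemma pf_dual_sylvester :
  pf a (al ++ c) =
  pf sylv_form ([seq inl x | x <- al] ++ [seq inr j | j <- iota 0 (size b)]).
Proof.
have A := dual_form_anti.
have inl_nopos s i : pos i \notin [seq inl x | x <- s] by apply/mapP => -[].
have nodag_inl s : all no_dag (map inl s) by rewrite all_map; apply/allP.
rewrite -{1}[al]map_undual_inl -(@pf_dual_cancel _ (size b)) //.
have nodag_base : all no_dag (posb ++ inc).
  by rewrite all_cat nodag_inl all_map andbT; apply/allP.
have base : pf dual_form (posb ++ inc) = 1.
  by rewrite pf_undual // map_cat map_undual_posb map_undual_inl.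
rewrite catA (pf_sylvester two_neq0 A _ base).
pose h (u : T + nat) : T' := match u with inl x => inl x | inr j => dag j end.
have -> : map inl al ++ [seq dag j | j <- iota 0 (size b)] =
    map h ([seq inl x | x <- al] ++ [seq inr j | j <- iota 0 (size b)]).
  by rewrite map_cat -!map_comp.
rewrite pf_map; apply: eq_pf.
have mixed x j : (j < size b)%N -> pf dual_form [:: inl x, dag j & posb ++ inc] =
    pf a (x :: (take j b ++ drop j.+1 b) ++ c).
  move=> hj; rewrite (posb_split hj) -catA /= (@pf_remove_dag [:: inl x]) //=; last first.
    rewrite mem_cat negb_or inl_nopos andbT; apply/mapP => -[i].
    by rewrite mem_iota => /andP[hi _] [ei]; rewrite ei ltnn in hi.
  rewrite pf_undual /=; last first.
    by rewrite !all_cat nodag_inl !all_map andbT; apply/andP; split; apply/allP.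
  rewrite !map_cat map_undual_inl -!map_comp -catA; congr (pf a (_ :: _ ++ _ ++ _)).
    by rewrite -(map_nth_iota0 x0) // ltnW.
  transitivity [seq nth x0 b i | i <- iota j.+1 (size b - j.+1)]; first by [].
  by rewrite map_nth_iota ?subnKC // take_oversize // size_drop.
have mem_inr j : inr j \in [seq inl x | x <- al] ++ [seq inr j | j <- iota 0 (size b)] ->
    (j < size b)%N.
  rewrite mem_cat => /orP[/mapP[]//|/mapP[k]].
  by rewrite mem_iota add0n => /andP[_ hk] [->].
case=> [x|j] [y|k] /= hu hv.
- by rewrite pf_undual //= map_cat map_undual_posb map_undual_inl.
- by rewrite mixed // mem_inr.
- by rewrite (pf_swap_head A) mixed // mem_inr.
rewrite (pf_move A [:: dag j]) (pf_move A [::]) /=.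
(* Moved behind [posb], the two letters and [c] form an isotropic word that is
   longer than [posb]. *)
rewrite pf_isotropic ?mulr0 //.
  move=> u v; rewrite !inE => /or3P[/eqP->|/eqP->|/mapP[x hx ->]];
    move=> /or3P[/eqP->|/eqP->|/mapP[y hy ->]] //=.
  exact: c_iso.
by rewrite /= !size_map size_iota size_bc.
Qed.

End DualSylvester.

(** * The minor summation formula *)

Fixpoint subseqs (T : Type) (s : seq T) : seq (seq T) :=
  if s is x :: s' then map (cons x) (subseqs s') ++ subseqs s' else [:: [::]].

Lemma alt_sum_rev (R : comNzRingType) (T : eqType) (g : T -> seq T -> R) s :
  alt_sum g (rev s) = - (-1) ^+ size s * alt_sum (fun x t => g x (rev t)) s.
Proof.
elim: s g => [|x s IH] g; first by rewrite mulr0.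
rewrite rev_cons -cats1 alt_sum_cat IH /= size_rev.
rewrite (eq_alt_sum (g' := fun y t => g y (rev (x :: t)))); last first.
  by move=> y t _; rewrite rev_cons cats1.
by rewrite exprS cats0; ring.
Qed.

Lemma sum_subseqs_nil (R : nmodType) (T : eqType) (f : seq T -> R) s :
  (forall x t, f (x :: t) = 0) -> \sum_(t <- subseqs s) f t = f [::].
Proof.
move=> f0; elim: s => [|x s IH] /=; first by rewrite big_seq1.
by rewrite big_cat big_map /= big1 ?add0r // => t _; apply: f0.
Qed.

Section MinorSum.
Variables (R : idomainType).
Hypothesis two_neq0 : (2 : R) != 0.

(** A subword with a marked letter [x] is the same as a subword [t] together
    with a letter to insert; the sign of the marking is the one needed to bring
    [x] to the front of [G].  When [x] already occurs in [t] the term on the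
    right vanishes. *)
Lemma sum_alt_sum_subseqs (T : eqType) (F : T -> seq T -> R) (G : seq T -> R) s :
  (forall u x y v, G (u ++ x :: y :: v) = - G (u ++ y :: x :: v)) ->
  \sum_(t <- subseqs s) alt_sum F t * G t =
  \sum_(t <- subseqs s) \sum_(x <- s) F x t * G (x :: t).
Proof.
elim: s F G => [|e s IH] F G hG /=.
  by rewrite !big_seq1 big_nil /= mul0r.
rewrite !big_cat /= !big_map IH //.
under eq_bigr => t _ do rewrite /= mulrBl.
rewrite sumrB (IH (fun x t => F x (e :: t)) (fun t => G (e :: t))); last first.
  by move=> u; apply: (hG (e :: u)).
have -> : \sum_(t <- subseqs s) \sum_(x <- e :: s) F x (e :: t) * G [:: x, e & t] =
    - \sum_(t <- subseqs s) \sum_(x <- s) F x (e :: t) * G [:: e, x & t].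
  rewrite -sumrN; apply: eq_bigr => t _; rewrite big_cons -sumrN.
  have -> : G [:: e, e & t] = 0 by apply: (eq_opp_eq0 two_neq0); apply: (hG [::]).
  rewrite mulr0 add0r; apply: eq_bigr => x _.
  by rewrite (hG [::] e x t) mulrN opprK.
under [X in _ = _ + X]eq_bigr => t _ do rewrite big_cons.
by rewrite big_split /=; ring.
Qed.

Variables (W C : eqType) (A : W -> W -> R) (T : W -> C -> R) (B : C -> C -> R).
Hypothesis A_anti : forall x y, A x y = - A y x.
Hypothesis B_anti : forall x y, B x y = - B y x.

(** The skew-symmetric block matrix with blocks [A], [T], [- T^t] and [0]. *)
Definition bordered_form (u v : W + C) : R :=
  match u, v with
  | inl x, inl y => A x y
  | inl x, inr c => T x c
  | inr c, inl x => - T x c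
  | inr _, inr _ => 0
  end.

Lemma bordered_form_anti u v : bordered_form u v = - bordered_form v u.
Proof. by case: u v => [x|c] [y|d] //=; rewrite ?opprK ?oppr0. Qed.

Let M (w : seq W) (I : seq C) : R := pf bordered_form (map inl w ++ map inr (rev I)).

(** Words of odd size have Pfaffian zero, so signs may be computed as if all
    sizes were even. *)
Lemma signr_M k w I : odd k = odd (size w + size I) -> (-1) ^+ k * M w I = M w I.
Proof.
case h: (odd (size w + size I)) => hk.
  by rewrite /M pf_odd ?mulr0 // size_cat !size_map size_rev.
by rewrite -signr_odd hk mul1r.
Qed.

Lemma M_nil x t : M [::] (x :: t) = 0.
Proof.
rewrite /M; apply: (@pf_isotropic _ _ _ [::]) => [u v /mapP[c _ ->] /mapP[d _ ->] //|].
by rewrite size_map size_rev.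
Qed.

Lemma M_swap w u x y v : M w (u ++ x :: y :: v) = - M w (u ++ y :: x :: v).
Proof.
rewrite /M !rev_cat !rev_cons -!cats1 -!catA /= !map_cat /= !catA.
by rewrite -!catA !catA (pf_swap bordered_form_anti).
Qed.

(** Expansion along a letter of [W]: the reversal of [I] in the definition of
    [M] makes the sign of the second sum that of [I] itself. *)
Lemma M_cons i w I : M (i :: w) I =
  alt_sum (fun y t => A i y * M t I) w + alt_sum (fun c J => T i c * M w J) I.
Proof.
rewrite {1}/M /= pf_cons alt_sum_cat !alt_sum_mapE alt_sum_rev size_map; congr (_ + _).
rewrite -!alt_sumZ; apply: eq_alt_sum => c J /perm_size /= hJ.
rewrite -[pf _ _]/(M w J) -[in RHS](@signr_M (size w + size J) w J) // -hJ exprS exprD; ring.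
Qed.

Lemma M_consr d w I : M w (d :: I) = alt_sum (fun y t => T y d * M t I) w.
Proof.
rewrite {1}/M rev_cons -cats1 map_cat catA /=.
set u := map inl w ++ _.
have su : size u = (size w + size I)%N by rewrite size_cat !size_map size_rev.
have := pf_move bordered_form_anti [::] (inr d) u [::].
rewrite /= cats0 => /(congr1 ( *%R ((-1) ^+ size u))).
rewrite mulrA -expr2 sqrr_sign mul1r => <-.
rewrite pf_cons alt_sum_cat !alt_sum_mapE [X in _ + _ * X]alt_sum0; last first.
  by move=> c t _; apply: mul0r.
rewrite mulr0 addr0 -alt_sumZ; apply: eq_alt_sum => y t /perm_size /= ht.
rewrite -[pf _ _]/(M t I) -[in RHS](@signr_M (size t + size I) t I) // su -ht /= addSn exprS; ring.
Qed.

(** The analogue for Pfaffians of the Cauchy--Binet formula, expanding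
    [Pf (A + T B T^t)] over the subwords of the index set of [B].  By induction
    on [w]: the right-hand side is expanded along the first entry [i] of [w],
    and the terms in which [i] is paired with some [c] in [I] are moved through
    [sum_alt_sum_subseqs] twice, so that [c] is first transferred to [pf B],
    where it is paired with some [d], and [d] is then transferred back to [M],
    where it is paired with an entry of [w]. *)
Lemma pf_minor_sum (s : seq C) w :
  pf (fun x y => A x y + \sum_(c <- s) \sum_(d <- s) T x c * B c d * T y d) w =
  \sum_(I <- subseqs s) M w I * pf B I.
Proof.
have [n] := ubnP (size w); elim: n w => // n IH [|i w] /= /ltnSE hn.
  rewrite sum_subseqs_nil => [|x t]; last by rewrite M_nil mul0r.
  by rewrite mul1r.
rewrite pf_cons.
rewrite (eq_alt_sum (g' := fun y t => \sum_(I <- subseqs s) A i y * M t I * pf B I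
    + \sum_(c <- s) \sum_(d <- s) \sum_(I <- subseqs s)
        T i c * B c d * pf B I * (T y d * M t I))); last first.
  move=> y t /perm_size /= ht; rewrite IH; last lia.
  rewrite mulrDl mulr_sumr; congr (_ + _).
    by apply: eq_bigr => I _; rewrite mulrA.
  rewrite mulr_suml; apply: eq_bigr => c _; rewrite mulr_suml; apply: eq_bigr => d _.
  by rewrite mulr_sumr; apply: eq_bigr => I _; ring.
rewrite alt_sumD alt_sum_bigE.
under [RHS]eq_bigr => I _ do rewrite M_cons mulrDl.
rewrite big_split /=; congr (_ + _).
  by apply: eq_bigr => I _; rewrite alt_sumZr.
(* [c] leaves [M] for [pf B]. *)
rewrite sum_alt_sum_subseqs; last by move=> u x y v; apply: pf_swap.
rewrite exchange_big alt_sum_bigE /=; apply: eq_bigr => c _.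
under [RHS]eq_bigr => I _ do rewrite pf_cons -mulrA -[M w I * _]mulrC.
(* [d] leaves [pf B] for [M]. *)
rewrite -mulr_sumr sum_alt_sum_subseqs; last exact: M_swap.
rewrite alt_sum_bigE exchange_big mulr_sumr; apply: eq_bigr => d _.
rewrite alt_sum_bigE mulr_sumr; apply: eq_bigr => I _.
by rewrite alt_sumZ M_consr; ring.
Qed.

End MinorSum.

(** * The two-row functions of a sequence *)

Section Convolution.
Variable R : comNzRingType.
Implicit Types (x f g : nat -> R).

(** The coefficients of the product of the generating series of [x] and [f]. *)
Definition conv x f a : R := \sum_(c < a.+1) x (a - c)%N * f c.

Lemma eq_conv x f g a : f =1 g -> conv x f a = conv x g a.
Proof. by move=> e; apply: eq_bigr => c _; rewrite e. Qed.

Lemma convD x f g a : conv x (fun c => f c + g c) a = conv x f a + conv x g a.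
Proof. by rewrite -big_split; apply: eq_bigr => c _; rewrite mulrDr. Qed.

Lemma convN x f a : conv x (fun c => - f c) a = - conv x f a.
Proof. by rewrite -sumrN; apply: eq_bigr => c _; rewrite mulrN. Qed.

Lemma convZ x k f a : conv x (fun c => k * f c) a = k * conv x f a.
Proof. by rewrite mulr_sumr; apply: eq_bigr => c _; rewrite mulrCA. Qed.

Lemma convZr x k f a : conv x (fun c => f c * k) a = conv x f a * k.
Proof. by rewrite mulr_suml; apply: eq_bigr => c _; rewrite mulrA. Qed.

Lemma convS x f a : conv x f a.+1 = x a.+1 * f 0%N + conv x (fun c => f c.+1) a.
Proof. by rewrite /conv big_ord_recl subn0. Qed.

Lemma conv0 x f : conv x f 0 = x 0%N * f 0%N.
Proof. by rewrite /conv big_ord1. Qed.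

Lemma conv_delta x a : conv x (fun c => (c == 0%N)%:R) a = x a.
Proof.
by rewrite /conv big_ord_recl subn0 mulr1 big1 ?addr0 // => c _; rewrite mulr0.
Qed.

(** The entries of the block [T]; see [Q1_qdiff]. *)
Definition qdiff x a c : R := if (c <= a)%N then x (a - c)%N else 0.

Lemma conv_qdiff x f a N : (a <= N)%N -> conv x f a = \sum_(c < N.+1) qdiff x a c * f c.
Proof.
move=> aN; rewrite /conv (big_ord_widen N.+1 (fun c => x (a - c)%N * f c)) //.
rewrite big_mkcond; apply: eq_bigr => c _; rewrite /qdiff ltnS.
by case: ifP => // _; rewrite mul0r.
Qed.

(** The coefficient of [z ^ a w ^ b] in [x(z) x(w) (z - w) / (z + w)], expanded
    in powers of [w / z]; multiplying by [z + w] gives [q2gt_rec]. *)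
Definition q2gt x a b : R :=
  x a * x b + 2 * \sum_(1 <= i < b.+1) (-1) ^+ i * x (a + i)%N * x (b - i)%N.

(** The coefficients of [(x(z) x(w) - 1) (z - w) / (z + w)], which is a power
    series when [x] is a [qseq]; the subtraction of [1] removes the value of
    [q2gt] at [(0, 0)]. *)
Definition q2 x a b : R :=
  if (b < a)%N then q2gt x a b else if (a < b)%N then - q2gt x b a else 0.

Lemma q2_anti x a b : q2 x a b = - q2 x b a.
Proof. by rewrite /q2; case: ltngtP; rewrite ?oppr0 ?opprK. Qed.

Lemma q2gt_rec x a b :
  q2gt x a b.+1 + q2gt x a.+1 b = x a * x b.+1 - x a.+1 * x b.
Proof.
rewrite /q2gt big_nat_recl // expr1 addn1 subSS subn0.
have -> : \sum_(1 <= i < b.+1) (-1) ^+ i.+1 * x (a + i.+1)%N * x (b.+1 - i.+1)%N =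
    - \sum_(1 <= i < b.+1) (-1) ^+ i * x (a.+1 + i)%N * x (b - i)%N.
  rewrite -sumrN; apply: eq_bigr => i _; rewrite exprS addSnnS subSS; ring.
ring.
Qed.

(** The series [x(z)] has constant term [1] and [x(z) x(-z) = 1], so that
    [z + w] divides [x(z) x(w) - 1]. *)
Definition qseq x : Prop :=
  x 0%N = 1 /\ forall k, \sum_(i < k.+2) (-1) ^+ i * x i * x (k.+1 - i)%N = 0.

(** The symmetrisation of [q2gt] satisfies [D a b.+1 = - D a.+1 b], so it
    vanishes as soon as it does for [b = 0], which is the relation
    [x(z) x(-z) = 1]. *)
Lemma q2gt_anti x a b : qseq x -> (0 < a + b)%N -> q2gt x a b = - q2gt x b a.
Proof.
move=> [x0 xk]; pose D a b := q2gt x a b + q2gt x b a.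
have Drec a' b' : D a' b'.+1 = - D a'.+1 b'.
  have e1 := q2gt_rec x a' b'; have e2 := q2gt_rec x b' a'.
  apply/eqP; rewrite -subr_eq0 opprK; apply/eqP.
  transitivity (q2gt x a' b'.+1 + q2gt x a'.+1 b' + (q2gt x b' a'.+1 + q2gt x b'.+1 a')).
    by rewrite /D; ring.
  by rewrite e1 e2; ring.
have D0 k : D k.+1 0%N = 0.
  have e : \sum_(1 <= i < k.+2) (-1) ^+ i * x (0 + i)%N * x (k.+1 - i)%N = - x k.+1.
    have := xk k; rewrite big_ord_recl expr0 mul1r x0 mul1r subn0 big_add1 big_mkord.
    by move/eqP; rewrite addrC addr_eq0 => /eqP.
  by rewrite /D /q2gt big_geq // e x0; ring.
have D_eq0 b' a' : (0 < a' + b')%N -> D a' b' = 0.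
  elim: b' a' => [|b' IH] a' h; last by rewrite Drec IH ?oppr0.
  by case: a' h => // a' _; apply: D0.
by move=> h; apply/eqP; rewrite -subr_eq0 opprK; apply/eqP/D_eq0.
Qed.

End Convolution.

Section QSequence.
Variable R : idomainType.
Hypothesis two_neq0 : (2 : R) != 0.
Implicit Types (x y : nat -> R).

Lemma q2E x a b : qseq x -> (0 < a + b)%N -> q2 x a b = q2gt x a b.
Proof.
move=> hx h; rewrite /q2; case: ltngtP => // [ab|ab]; first by rewrite [RHS]q2gt_anti.
by apply/esym/(eq_opp_eq0 two_neq0); rewrite -ab in h *; apply: q2gt_anti.
Qed.

Lemma q2_rec x a b : qseq x ->
  q2 x a b.+1 + q2 x a.+1 b = x a * x b.+1 - x a.+1 * x b.
Proof. by move=> hx; rewrite !q2E ?addnS // q2gt_rec. Qed.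

Lemma q2_r0 x a : qseq x -> q2 x a 0 = x a - (a == 0%N)%:R.
Proof.
move=> hx; case: a => [|a]; first by rewrite /q2 /= hx.1 subrr.
by rewrite q2E ?addn0 // /q2gt big_geq // hx.1 mulr0 addr0 mulr1 subr0.
Qed.

(** The recursion [q2_rec] lowers the second index to [0]. *)
Lemma q2_unique x (f : nat -> nat -> R) a b : qseq x ->
  (forall a, f a 0%N = x a - (a == 0%N)%:R) ->
  (forall a b, f a b.+1 + f a.+1 b = x a * x b.+1 - x a.+1 * x b) ->
  q2 x a b = f a b.
Proof.
move=> hx f0 fS; elim: b a => [|b IH] a; first by rewrite q2_r0 // f0.
by apply: (@addIr _ (q2 x a.+1 b)); rewrite q2_rec // IH fS.
Qed.

(** In generating series, with [z = conv x y], this is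
    [(z(s) z(t) - 1) = (x(s) x(t) - 1) + x(s) x(t) (y(s) y(t) - 1)], multiplied
    by [(s - t) / (s + t)].  The division is avoided by checking that the
    right-hand side satisfies the hypotheses of [q2_unique]. *)
Lemma q2_conv x y a b : qseq x -> qseq y -> qseq (conv x y) ->
  q2 (conv x y) a b = q2 x a b + conv x (fun c => conv x (q2 y c) b) a.
Proof.
move=> hx hy hz; pose z := conv x y.
have conv_r0 e : conv x (fun c => q2 y c 0) e = z e - x e.
  rewrite -(conv_delta x e) -convN -convD; apply: eq_conv => c; exact: q2_r0.
apply: (@q2_unique _ (fun a b => q2 x a b + conv x (fun c => conv x (q2 y c) b) a)) => //.
  move=> {}a; rewrite (@eq_conv _ _ _ (fun c => q2 y c 0)) => [|c].
    by rewrite conv_r0 q2_r0 //; rewrite /z; ring.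
  by rewrite conv0 hx.1 mul1r.
move=> {}a {}b.
have conv_l0 e : conv x (q2 y 0) e = x e - z e.
  rewrite (@eq_conv _ _ _ (fun c => - q2 y c 0)) => [|c]; last exact: q2_anti.
  by rewrite convN conv_r0 opprB.
have tailE e : conv x (fun c => y c.+1) e = z e.+1 - x e.+1.
  by rewrite /z convS hy.1 mulr1; ring.
rewrite (@eq_conv _ _ _ (fun c => x b.+1 * q2 y c 0 + conv x (fun d => q2 y c d.+1) b)); last first.
  by move=> c; apply: convS.
rewrite convD convZ conv_r0 [conv x _ a.+1]convS conv_l0.
have : conv x (fun c => conv x (fun d => q2 y c d.+1) b) a + conv x (fun c => conv x (q2 y c.+1) b) a
    = z a * (z b.+1 - x b.+1) - (z a.+1 - x a.+1) * z b.
  rewrite -!tailE -convD.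
  rewrite (@eq_conv _ _ _ (fun c => y c * conv x (fun d => y d.+1) b + - (y c.+1 * conv x y b))).
    by rewrite convD convN !convZr.
  move=> c; rewrite -convD -!convZ -convN -convD; apply: eq_conv => d; exact: q2_rec.
set S1 := conv x _ a; set S2 := conv x _ a => e.
have e0 := q2_rec a b hx; rewrite -/z.
transitivity ((q2 x a b.+1 + q2 x a.+1 b) + (S1 + S2) + x b.+1 * (z a - x a)
  + x a.+1 * (x b - z b)); first by ring.
rewrite e0 e; ring.
Qed.

End QSequence.

Fixpoint down N : seq nat := if N is N'.+1 then N :: down N' else [::].

Lemma mem_down N k : (k \in down N) = (0 < k <= N)%N.
Proof.
elim: N => [|N IH] /=; first by case: k.
by rewrite inE IH; lia.
Qed.

Lemma sum_down (R : nmodType) (f : nat -> R) N :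
  \sum_(c <- rcons (down N) 0%N) f c = \sum_(c < N.+1) f c.
Proof.
elim: N => [|N IH]; first by rewrite big_seq1 big_ord1.
by rewrite big_cons IH [RHS]big_ord_recr addrC.
Qed.

(** The matrix form [S(x, y) = S(x) + T(x) S(y) T(x)^t] of [q2_conv], with a
    common decreasing range of summation, in the form used in [pf_minor_sum]. *)
Lemma q2_conv_down (R : idomainType) (x y : nat -> R) N a b : (2 : R) != 0 ->
  qseq x -> qseq y -> qseq (conv x y) -> (a <= N)%N -> (b <= N)%N ->
  q2 (conv x y) a b = q2 x a b + \sum_(c <- rcons (down N) 0%N)
    \sum_(d <- rcons (down N) 0%N) qdiff x a c * q2 y c d * qdiff x b d.
Proof.
move=> two_neq0 hx hy hz aN bN; rewrite q2_conv //; congr (_ + _).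
rewrite sum_down (conv_qdiff _ _ aN); apply: eq_bigr => c _.
rewrite sum_down (conv_qdiff _ _ bN) mulr_sumr; apply: eq_bigr => d _; ring.
Qed.

(** * Bordered Pfaffians of a sequence *)

Lemma gtn_trans : transitive gtn.
Proof. by move=> b a c h1 h2; apply: ltn_trans h2 h1. Qed.

Section SkewQ.
Variable R : idomainType.
Implicit Types (x y : nat -> R) (al mu : seq nat).

Definition qform x : nat + nat -> nat + nat -> R := bordered_form (q2 x) (qdiff x).

Lemma qform_anti x u v : qform x u v = - qform x v u.
Proof. exact/bordered_form_anti/q2_anti. Qed.

(** The rows of the block matrix of [al] and [be]: the letters [inl] index the
    blocks [S], the letters [inr] the columns of [T], whose order is reversed. *)
Definition bordered al be : seq (nat + nat) := map inl al ++ map inr (rev be).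

(** With [qpf], the Pfaffians defining [Qext] and [Qfun], for the sequence [x]
    in place of the [q_k]; see [QextE] and [QfunE]. *)
Definition qskew x al mu : R :=
  pf (qform x) (bordered al (pad (odd (size al + size mu)) mu)).

Definition qpf x mu : R := pf (q2 x) (pad (odd (size mu)) mu).

(** The column of [m] in the block [T] is zero. *)
Lemma qskew_large x al mu m : m \in mu ->
  {in al, forall a, (a < m)%N} -> qskew x al mu = 0.
Proof.
move=> hm h; rewrite /qskew /bordered.
have size_even : ~~ odd (size al + size (pad (odd (size al + size mu)) mu)).
  by rewrite /pad; case: ifP => [e|->//]; rewrite size_rcons addnS /= e.
have hm' : m \in pad (odd (size al + size mu)) mu.
  by rewrite /pad; case: ifP => // _; rewrite mem_rcons inE hm orbT.
apply: (@pf_zero_entry _ _ _ (@qform_anti x) (inr m)).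
- rewrite size_cat !size_map size_rev.
  by case: (pad _ _) hm' size_even => // c be _ /=; lia.
- by rewrite mem_cat (map_f inr) ?mem_rev // orbT.
move=> u; rewrite mem_cat => /orP[]/mapP[c hc ->] //=.
by rewrite /qform /= /qdiff leqNgt h // oppr0.
Qed.

(** The block [T] is triangular for the reversed order of its columns, with
    ones on the diagonal: the column of the first part can only be matched with
    that part. *)
Lemma qskew_diag x mu : qseq x -> sorted gtn mu -> pf (qform x) (bordered mu mu) = 1.
Proof.
move=> [x0 _]; elim: mu => [|p mu IH] //= hp.
have hlt (c : nat) : c \in mu -> (c < p)%N.
  by move/(allP (order_path_min gtn_trans hp)).
rewrite /bordered /= rev_cons -cats1 map_cat catA /= pf_ends; last 2 first.
- exact: qform_anti.
- move=> u; rewrite mem_cat => /orP[]/mapP[c hc ->] //.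
  by rewrite /qform /= /qdiff leqNgt hlt // oppr0.
rewrite -[pf _ _]/(pf (qform x) (bordered mu mu)) IH ?(path_sorted hp) // mulr1.
rewrite /qform /= /qdiff leqnn subnn x0 mulr1.
by rewrite size_cat !size_map size_rev -signr_odd oddD addbb.
Qed.

Hypothesis two_neq0 : (2 : R) != 0.

(** The part [0] and the column of [0] have the same entries, namely the [q_k],
    against all nonzero parts and columns. *)
Lemma qform_zero x u : qseq x -> (if u is inl a then a != 0%N else u != inr 0%N) ->
  qform x (inl 0%N) u = qform x (inr 0%N) u.
Proof.
move=> hx; case: u => [a|c] hu /=.
  by rewrite q2_anti q2_r0 // (negPf hu) subr0 /qdiff leq0n subn0.
rewrite /qdiff leqn0; case: eqP => // c0; by rewrite c0 in hu.
Qed.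

Lemma pf_bordered_pair0 x al mu : qseq x -> 0%N \notin al -> 0%N \notin mu ->
  pf (qform x) (bordered (rcons al 0%N) (rcons mu 0%N)) = pf (qform x) (bordered al mu).
Proof.
move=> hx al0 mu0; rewrite /bordered rev_rcons -cats1 map_cat -catA /=.
apply: (pf_cancel_pair two_neq0 (@qform_anti x)).
  by rewrite /qform /= /qdiff subnn hx.1.
move=> u; rewrite mem_cat => hu; apply: qform_zero => //.
case: u hu => [a|c] /orP[] /mapP[b hb] // [e].
  by apply: contraNneq al0 => a0; rewrite -a0 e.
by apply: contraNneq mu0 => -[c0]; rewrite -c0 e -mem_rev.
Qed.

Lemma pf_bordered_move0 x al mu : qseq x -> 0%N \notin al -> 0%N \notin mu ->
  pf (qform x) (bordered (rcons al 0%N) mu) = pf (qform x) (bordered al (rcons mu 0%N)).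
Proof.
move=> hx al0 mu0; rewrite /bordered rev_rcons -cats1 map_cat -catA /=.
apply: (pf_replace (@qform_anti x)).
move=> u; rewrite mem_cat => hu; apply: qform_zero => //.
case: u hu => [a|c] /orP[] /mapP[b hb] // [e].
  by apply: contraNneq al0 => a0; rewrite -a0 e.
by apply: contraNneq mu0 => -[c0]; rewrite -c0 e -mem_rev.
Qed.

Lemma subseqs_mem (s t : seq nat) : t \in subseqs s -> {subset t <= s}.
Proof.
elim: s t => [|c s IH] t /=; first by rewrite inE => /eqP->.
rewrite mem_cat => /orP[/mapP[r /IH h ->]|/IH h] k.
  by rewrite !inE => /orP[->//|/h ->]; rewrite orbT.
by move/h; rewrite inE orbC => ->.
Qed.

Lemma sum_subseqs_rcons (V : nmodType) (f : seq nat -> V) s c :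
  \sum_(t <- subseqs (rcons s c)) f t = \sum_(t <- subseqs s) (f t + f (rcons t c)).
Proof.
elim: s f => [|e s IH] f /=; first by rewrite big_cons !big_seq1 addrC.
by rewrite !big_cat !big_map !IH.
Qed.

(** The Jozefiak--Pragacz formula.  Since [S(x, y) = S(x) + T(x) S(y) T(x)^t],
    the Pfaffian on the left is given by [pf_minor_sum] with index set
    [N, ..., 1, 0].  A subword of it is [mu] or [mu] followed by [0]; parity
    kills one of the two, and the other one is the term of [mu], the paddings
    by zeros being matched by [pf_bordered_pair0] and [pf_bordered_move0]. *)
Lemma qskew_expansion x y la N : qseq x -> qseq y -> qseq (conv x y) ->
  0%N \notin la -> {in la, forall a, (a <= N)%N} ->
  qpf (conv x y) la = \sum_(mu <- subseqs (down N)) qskew x la mu * qpf y mu.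
Proof.
move=> hx hy hz la0 laN; rewrite /qpf; set w := pad _ la.
have wN : {in w, forall a, (a <= N)%N}.
  rewrite /w /pad; case: ifP => // _ a; rewrite mem_rcons inE => /orP[/eqP->//|].
  exact: laN.
have w_even : ~~ odd (size w).
  by rewrite /w /pad; case: ifP => [h|->//]; rewrite size_rcons /= h.
rewrite (@eq_pf _ _ _ (fun a b => q2 x a b + \sum_(c <- rcons (down N) 0%N)
   \sum_(d <- rcons (down N) 0%N) qdiff x a c * q2 y c d * qdiff x b d)); last first.
  by move=> a b /wN aN /wN bN; apply: q2_conv_down.
rewrite pf_minor_sum ?sum_subseqs_rcons //; try exact: q2_anti.
rewrite !big_seq; apply: eq_bigr => mu /subseqs_mem hmu.
have mu0 : 0%N \notin mu by apply/negP => /hmu; rewrite mem_down.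
rewrite /qskew /pad oddD -/(bordered w mu) -/(bordered w (rcons mu 0%N)).
rewrite /w /pad; case mu_odd: (odd (size mu)).
  rewrite [pf (q2 y) mu]pf_odd // mulr0 add0r; congr (_ * _).
  by case: ifP => h /=; rewrite ?pf_bordered_pair0.
rewrite [pf (q2 y) (rcons mu 0%N)]pf_odd ?size_rcons /= ?mu_odd // mulr0 addr0; congr (_ * _).
by case: ifP => h /=; rewrite ?pf_bordered_move0.
Qed.

Lemma qpf_bordered x mu : qpf x mu = pf (qform x) (bordered (pad (odd (size mu)) mu) [::]).
Proof. by rewrite /bordered cats0 pf_map. Qed.

(** The column of [m] can only be matched with the part [m]. *)
Lemma qskew_first x m mu : qseq x -> (0 < m)%N -> 0%N \notin mu ->
  {in mu, forall a, (a < m)%N} -> qskew x (m :: mu) [:: m] = qpf x mu.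
Proof.
move=> hx m0 mu0 hlt; rewrite qpf_bordered /qskew /= addn1 /= negbK.
transitivity (pf (qform x) (bordered mu (if odd (size mu) then [:: 0%N] else [::]))).
  have ends be : (if odd (size mu) then [:: 0%N] else [::]) = be ->
     pf (qform x) (bordered (m :: mu) (m :: be)) = pf (qform x) (bordered mu be).
    move=> hbe; rewrite /bordered /= rev_cons -cats1 map_cat catA /= pf_ends; last 2 first.
    - exact: qform_anti.
    - move=> u; rewrite mem_cat => /orP[]/mapP[c hc ->] //.
      by rewrite /qform /= /qdiff leqNgt hlt // oppr0.
    rewrite {1}/qform /= /qdiff leqnn subnn hx.1 mulr1 size_cat !size_map size_rev.
    rewrite -signr_odd oddD -hbe; case: (odd (size mu)) => /=; exact: mul1r.
  by rewrite -ends //; case: ifP.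
case: ifP => h //=.
by rewrite (@pf_bordered_move0 x mu [::]).
Qed.

End SkewQ.

(** * Sequences attached to values of the variables, and linear independence *)

Section Values.
Variable R : comNzRingType.
Implicit Types (xs ys : seq R) (p q : {poly R}).

(** Agrees with the series [(1 + x z) / (1 - x z)] modulo [z ^ N]. *)
Definition q_factor N (x : R) : {poly R} :=
  (1 + x%:P * 'X) * \sum_(j < N) (x ^+ j)%:P * 'X^j.

(** [q_k] at the values [xs]; any larger truncation gives the same coefficient
    ([q_at_upto]). *)
Definition q_at xs k : R := (\prod_(x <- xs) q_factor k.+1 x)`_k.

Definition eq_upto N p q := forall i, (i < N)%N -> p`_i = q`_i.

Lemma eq_uptoM N p1 p2 q1 q2 :
  eq_upto N p1 p2 -> eq_upto N q1 q2 -> eq_upto N (p1 * q1) (p2 * q2).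
Proof.
move=> hp hq i hi; rewrite !coefM; apply: eq_bigr => j _.
by rewrite hp ?hq //; have := ltn_ord j; lia.
Qed.

Lemma eq_upto_prod N xs (f g : R -> {poly R}) :
  (forall x, eq_upto N (f x) (g x)) ->
  eq_upto N (\prod_(x <- xs) f x) (\prod_(x <- xs) g x).
Proof. by move=> h; elim/big_rec2: _ => // x p q _; apply: eq_uptoM. Qed.

Lemma q_factor_upto N M x : (N <= M)%N -> eq_upto N (q_factor N x) (q_factor M x).
Proof.
have geomE K : \sum_(j < K) (x ^+ j)%:P * 'X^j = \poly_(j < K) x ^+ j.
  by rewrite poly_def; apply: eq_bigr => j _; rewrite mul_polyC.
move=> NM; apply: eq_uptoM => // i hi.
by rewrite !geomE !coef_poly hi (leq_trans hi NM).
Qed.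

Lemma q_at_upto N xs k : (k < N)%N -> q_at xs k = (\prod_(x <- xs) q_factor N x)`_k.
Proof.
by move=> kN; apply: (eq_upto_prod (N := k.+1)) => // x; apply: q_factor_upto.
Qed.

Lemma q_at_cat xs ys : q_at (xs ++ ys) =1 conv (q_at xs) (q_at ys).
Proof.
move=> k; rewrite /q_at big_cat coefMr; apply: eq_bigr => i _ /=.
by rewrite -!(@q_at_upto k.+1) //= ltnS leq_subr.
Qed.

Lemma q_factorN N x : q_factor N x * q_factor N (- x) =
  (1 - (x%:P * 'X) ^+ N) * (1 - (- x%:P * 'X) ^+ N).
Proof.
have geomE (y : R) : \sum_(j < N) (y ^+ j)%:P * 'X^j = \sum_(j < N) (y%:P * 'X) ^+ j.
  by apply: eq_bigr => j _; rewrite exprMn rmorphXn.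
have geo (z : {poly R}) : (1 - z) * \sum_(j < N) z ^+ j = 1 - z ^+ N.
  by rewrite -opprB mulNr -subrX1 opprB.
rewrite /q_factor !geomE -!geo polyCN; ring.
Qed.

(** [q_k] is homogeneous of degree [k]; only the sign change is needed, for the
    relation [q(z) q(-z) = 1]. *)
Lemma q_atN xs k : q_at (map -%R xs) k = (-1) ^+ k * q_at xs k.
Proof.
pose rel p q := forall i, q`_i = (-1) ^+ i * p`_i.
have relM p1 p2 q1 q2 : rel p1 q1 -> rel p2 q2 -> rel (p1 * p2) (q1 * q2).
  move=> h1 h2 i; rewrite !coefM mulr_sumr; apply: eq_bigr => j _.
  have -> : (-1) ^+ i = (-1) ^+ j * (-1) ^+ (i - j) :> R.
    by rewrite -exprD subnKC // leq_ord.
  rewrite h1 h2; ring.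
rewrite /q_at big_map; suff h : rel (\prod_(x <- xs) q_factor k.+1 x)
    (\prod_(x <- xs) q_factor k.+1 (- x)) by apply: h.
elim/big_rec2: _ => [|x p q _ h].
  by move=> [|i]; rewrite coef1 ?mulr0 // mulr1.
apply: (relM _ _ _ _ _ h); apply: relM => i.
  by rewrite !coefD !coefCM coefX coef1; case: i => [|[|i]] /=; rewrite ?expr1; ring.
rewrite !coef_sum mulr_sumr; apply: eq_bigr => j _.
rewrite !coefCM coefXn; case: eqP => [->|_]; last by rewrite !mulr0.
by rewrite /= !mulr1 [LHS]exprNn.
Qed.

(** The factors of [q(z; xs)] and [q(z; -xs)] are inverse to each other. *)
Lemma qseq_q_at xs : qseq (q_at xs).
Proof.
split.
  rewrite /q_at; elim: xs => [|x xs IH]; first by rewrite big_nil coef1.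
  rewrite big_cons coefM big_ord1 subnn IH mulr1 /q_factor big_ord1 expr0 mul1r expr0 mulr1.
  by rewrite coefD coefCM coefX coef1 mulr0 addr0.
move=> k; transitivity (q_at (xs ++ map -%R xs) k.+1).
  by rewrite q_at_cat; apply: eq_bigr => i _; rewrite q_atN mulrC.
rewrite (@q_at_upto k.+2) // big_cat /= big_map -big_split /=.
rewrite (@eq_upto_prod k.+2 xs _ (fun=> 1)) // ?big1 // ?coef1 // => x i hi.
rewrite q_factorN -[RHS](congr1 (fun p : {poly R} => p`_i) (mulr1 1)).
by apply: eq_uptoM hi => j hj; rewrite coefB -?polyCN exprMn -rmorphXn
  mul_polyC coefZ coefXn (ltn_eqF hj) mulr0 subr0.
Qed.

End Values.

Lemma rmorph_q_at (R S : comNzRingType) (phi : {rmorphism R -> S}) xs k :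
  phi (q_at xs k) = q_at (map phi xs) k.
Proof.
have e N x : map_poly phi (q_factor N x) = q_factor N (phi x).
  rewrite /q_factor rmorphM rmorphD rmorph1 rmorphM /= map_polyC map_polyX rmorph_sum.
  congr (_ * _); apply: eq_bigr => j _.
  rewrite rmorphM /= map_polyC map_polyXn; congr (_%:P * _); exact: (rmorphXn phi).
rewrite /q_at -coef_map rmorph_prod big_map; congr (polyseq _)`_k.
by apply: eq_bigr => x _; apply: e.
Qed.

Lemma eq_q2 (R : comNzRingType) (x y : nat -> R) : x =1 y -> q2 x =2 q2 y.
Proof.
move=> e; have gt a b : q2gt x a b = q2gt y a b.
  by rewrite /q2gt !e; congr (_ + 2 * _); apply: eq_bigr => i _; rewrite !e.
by move=> a b; rewrite /q2 !gt.
Qed.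

Lemma rmorph_q2 (R S : comNzRingType) (phi : {rmorphism R -> S}) x a b :
  phi (q2 x a b) = q2 (phi \o x) a b.
Proof.
have gt c d : phi (q2gt x c d) = q2gt (phi \o x) c d.
  rewrite /q2gt rmorphD !rmorphM rmorph_nat rmorph_sum; congr (_ + 2 * _).
  by apply: eq_bigr => i _; rewrite !rmorphM rmorphXn rmorphN1.
by rewrite /q2; case: ltngtP => _; rewrite ?rmorphN ?rmorph0 ?gt.
Qed.

Lemma rmorph_qpf (R S : idomainType) (phi : {rmorphism R -> S}) x mu :
  phi (qpf x mu) = qpf (phi \o x) mu.
Proof. by rewrite rmorph_pf; apply: eq_pf => a b _ _; apply: rmorph_q2. Qed.

Lemma rmorph_qform (R S : idomainType) (phi : {rmorphism R -> S}) x u v :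
  phi (qform x u v) = qform (phi \o x) u v.
Proof.
have qdiffE a c : phi (qdiff x a c) = qdiff (phi \o x) a c.
  by rewrite /qdiff; case: ifP; rewrite ?rmorph0.
case: u v => [a|c] [b|d]; rewrite /qform /= ?rmorphN ?qdiffE ?rmorph0 //.
exact: rmorph_q2.
Qed.

Lemma rmorph_qskew (R S : idomainType) (phi : {rmorphism R -> S}) x al mu :
  phi (qskew x al mu) = qskew (phi \o x) al mu.
Proof. by rewrite rmorph_pf; apply: eq_pf => u v _ _; apply: rmorph_qform. Qed.

Lemma eq_qpf (R : idomainType) (x y : nat -> R) mu : x =1 y -> qpf x mu = qpf y mu.
Proof. by move=> e; apply: eq_pf => a b _ _; apply: eq_q2. Qed.

Lemma eq_qskew (R : idomainType) (x y : nat -> R) al mu :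
  x =1 y -> qskew x al mu = qskew y al mu.
Proof.
move=> e; apply: eq_pf => u v _ _.
by case: u v => [a|c] [b|d]; rewrite /qform /= ?(eq_q2 e) // /qdiff e.
Qed.

Lemma q_at1 (R : comNzRingType) (x : R) k : q_at [:: x] k.+1 = 2 * x ^+ k.+1.
Proof.
rewrite /q_at big_seq1 /q_factor mulrDl mul1r coefD -mulrA coefCM ['X * _]mulrC coefMX /=.
have h N i : (i < N)%N -> (\sum_(j < N) (x ^+ j)%:P * 'X^j)`_i = x ^+ i.
  move=> iN; under eq_bigr => j _ do rewrite mul_polyC.
  by rewrite -(poly_def N (fun j => x ^+ j)) coef_poly iN.
by rewrite !h // -exprS mulr_natl mulr2n.
Qed.

Lemma sum_subseqs_down (V : nmodType) (f : seq nat -> V) N :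
  \sum_(t <- subseqs (down N.+1)) f t =
  \sum_(t <- subseqs (down N)) f (N.+1 :: t) + \sum_(t <- subseqs (down N)) f t.
Proof. by rewrite big_cat big_map. Qed.

Section OneVariable.
Variable R : idomainType.
Hypothesis two_neq0 : (2 : R) != 0.
Variable x : R.

(** In one variable the series [(x(z) x(w) - 1) (z - w) / (z + w)] is the
    difference of a series in [z] and one in [w]. *)
Lemma q2_q_at1 a b : q2 (q_at [:: x]) a.+1 b.+1 = 0.
Proof.
have hq := qseq_q_at [:: x].
elim: b a => [|b IH] a.
  apply: (@addIr _ (q2 (q_at [:: x]) a.+2 0)); rewrite (q2_rec two_neq0) //.
  rewrite q2_r0 // !q_at1 hq.1 expr1 (exprS x a.+1) /= subr0 add0r mulr1.
  by rewrite !mulr_natl !mulr2n; ring.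
apply: (@addIr _ (q2 (q_at [:: x]) a.+2 b.+1)); rewrite (q2_rec two_neq0) //.
by rewrite IH !q_at1 !exprS !mulr_natl !mulr2n; ring.
Qed.

Lemma qpf_q_at1_large mu : 0%N \notin mu -> (1 < size mu)%N -> qpf (q_at [:: x]) mu = 0.
Proof.
move=> mu0 hs.
have iso : {in mu &, forall a b, q2 (q_at [:: x]) a b = 0}.
  move=> [|a] [|b]; rewrite ?(negPf mu0) // => _ _; exact: q2_q_at1.
rewrite /qpf /pad; case: ifP => h; last by apply: (@pf_isotropic _ _ _ [::]); rewrite // ltnW.
rewrite -cats1 pf_to_front; last exact: q2_anti.
by rewrite cats0 (@pf_isotropic _ _ _ [:: 0%N]) ?mulr0.
Qed.

Lemma qpf_q_at1_single c : qpf (q_at [:: x]) [:: c.+1] = 2 * x ^+ c.+1.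
Proof.
rewrite /qpf /= pf_cons /= subr0 pf_nil mulr1 q2_r0 //; last exact: qseq_q_at.
by rewrite subr0 q_at1.
Qed.

End OneVariable.

(** In one variable only the partitions of length at most one contribute, and
    the degree singles out the part [N.+1]. *)
Lemma sum_qpf_q_at1 (R : idomainType) (k : seq nat -> R) N : (2 : R) != 0 ->
  (\sum_(mu <- subseqs (down N.+1)) (k mu)%:P * qpf (q_at [:: 'X]) mu)`_N.+1
  = k [:: N.+1] * 2.
Proof.
move=> two_neq0; have two_neq0' : (2 : {poly R}) != 0.
  by rewrite -polyC_natr polyC_eq0.
have large mu : mu \in subseqs (down N.+1) -> (1 < size mu)%N ->
    qpf (q_at [:: 'X : {poly R}]) mu = 0.
  move=> hmu; apply: qpf_q_at1_large => //.
  by apply/negP => /(subseqs_mem hmu); rewrite mem_down.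
rewrite coef_sum sum_subseqs_down.
rewrite [X in X + _](_ : _ = k [:: N.+1] * 2).
  rewrite big_seq big1 ?addr0 // => mu hmu.
  rewrite coefCM.
  case: mu hmu (large mu) => [|c [|d mu]] hmu hlarge.
  - by rewrite /qpf /= pf_nil coef1 mulr0.
  - have := subseqs_mem hmu (mem_head _ _); rewrite mem_down.
    case: c hmu hlarge => // c _ _ hc.
    rewrite qpf_q_at1_single // -polyC_natr coefCM coefXn.
    by rewrite gtn_eqF ?mulr0 //; lia.
  by rewrite hlarge ?coef0 ?mulr0 // mem_cat hmu orbT.
transitivity (\sum_(t <- subseqs (down N)) if t is [::] then k [:: N.+1] * 2 else 0).
  rewrite !big_seq; apply: eq_bigr => -[|c mu] hmu.
    by rewrite qpf_q_at1_single // coefCM -polyC_natr coefCM coefXn eqxx mulr1.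
  by rewrite large ?mulr0 ?coef0 // mem_cat (map_f (cons N.+1)).
by rewrite sum_subseqs_nil.
Qed.

(** A linear relation that holds for all values of the variables is separated
    as follows.  Adjoin one more variable ['X], expand by [qskew_expansion] and
    take the coefficient of ['X^N.+1]: by [sum_qpf_q_at1] only the column
    [N.+1] survives, hence only the partitions with first part [N.+1], each
    replaced by the partition of its other parts.  By induction the
    coefficients of these vanish, and then those of the partitions with smaller
    parts.  The relation is assumed over all [R] that receive [K], as the
    argument passes from [R] to [{poly R}]. *)
Lemma qpf_independent (K : comNzRingType) (C : seq nat -> K) N :
  (forall (R : idomainType) (phi : {rmorphism K -> R}) ys, (2 : R) != 0 ->
     \sum_(mu <- subseqs (down N)) phi (C mu) * qpf (q_at ys) mu = 0) ->
  forall (R : idomainType) (phi : {rmorphism K -> R}), (2 : R) != 0 ->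
  forall mu, mu \in subseqs (down N) -> phi (C mu) = 0.
Proof.
elim: N C => [|N IH] C H R phi two_neq0.
  move=> mu; rewrite inE => /eqP->.
  by have := H R phi [::] two_neq0; rewrite big_seq1 /qpf /= pf_nil mulr1.
have H1 (S : idomainType) (psi : {rmorphism K -> S}) ys : (2 : S) != 0 ->
    \sum_(mu <- subseqs (down N)) psi (C (N.+1 :: mu)) * qpf (q_at ys) mu = 0.
  move=> two_S.
  have two_poly : (2 : {poly S}) != 0 by rewrite -polyC_natr polyC_eq0.
  have := H {poly S} (polyC \o psi) (map polyC ys ++ [:: 'X]) two_poly.
  pose k nu := \sum_(mu <- subseqs (down N.+1)) psi (C mu) * qskew (q_at ys) mu nu.
  have -> : \sum_(mu <- subseqs (down N.+1)) (polyC \o psi) (C mu) *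
      qpf (q_at (map polyC ys ++ [:: 'X])) mu =
      \sum_(nu <- subseqs (down N.+1)) (k nu)%:P * qpf (q_at [:: 'X]) nu.
    rewrite /k; under [RHS]eq_bigr => nu _ do rewrite rmorph_sum mulr_suml.
    rewrite exchange_big !big_seq; apply: eq_bigr => mu /subseqs_mem hmu.
    rewrite (eq_qpf _ (q_at_cat _ _)) (@qskew_expansion _ _ _ _ _ N.+1) //; first last.
    - by move=> a /hmu; rewrite mem_down => /andP[].
    - by apply/negP => /hmu; rewrite mem_down.
    - split; first by rewrite -q_at_cat (qseq_q_at _).1.
      move=> j; under eq_bigr => i _ do rewrite -!q_at_cat.
      exact: (qseq_q_at _).2.
    - exact: qseq_q_at.
    - exact: qseq_q_at.
    rewrite mulr_sumr; apply: eq_bigr => nu _; rewrite mulrA; congr (_ * _).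
    rewrite [RHS]polyCM /=; congr (_ * _).
    rewrite rmorph_qskew; apply: eq_qskew => j; by rewrite /= rmorph_q_at.
  move=> /(congr1 (fun p : {poly S} => p`_N.+1)); rewrite sum_qpf_q_at1 // coef0.
  move/eqP; rewrite mulf_eq0 (negPf two_S) orbF => /eqP.
  rewrite /k sum_subseqs_down [X in _ + X]big_seq [X in _ + X]big1; last first.
    move=> mu hmu0; have hmu : {subset mu <= down N} := subseqs_mem hmu0.
    by rewrite (@qskew_large _ _ _ _ N.+1) ?mulr0 ?mem_head // => a /hmu; rewrite mem_down; lia.
  rewrite addr0 => h; rewrite -[RHS]h !big_seq; apply: eq_bigr => mu hmu0.
  have hmu : {subset mu <= down N} := subseqs_mem hmu0.
  rewrite qskew_first //; first exact: qseq_q_at.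
    by apply/negP => /hmu; rewrite mem_down.
  by move=> a /hmu; rewrite mem_down; lia.
have C1 (S : idomainType) (psi : {rmorphism K -> S}) : (2 : S) != 0 ->
    forall mu, mu \in subseqs (down N) -> psi (C (N.+1 :: mu)) = 0.
  exact: (IH (fun mu => C (N.+1 :: mu))).
move=> mu /=; rewrite mem_cat => /orP[/mapP[t ht ->]|]; first exact: C1.
apply: IH two_neq0 mu => S psi ys two_S.
have := H S psi ys two_S; rewrite sum_subseqs_down big_seq big1 ?add0r // => t ht.
by rewrite C1 ?mul0r.
Qed.

(** * Passage to polynomials *)

Lemma Pf_block_pf (R : comNzRingType) (T : eqType) (a : T -> T -> R) x0
    (s1 s2 : seq T) p q (A : 'M[R]_p) (B : 'M[R]_(p, q)) :
  size s1 = p -> size s2 = q -> ~~ odd (p + q) ->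
  (forall i j, A i j = a (nth x0 s1 i) (nth x0 s1 j)) ->
  (forall i j, B i j = a (nth x0 s1 i) (nth x0 s2 j)) ->
  (forall i j, B i j = - a (nth x0 s2 j) (nth x0 s1 i)) ->
  {in s2 &, forall x y, a x y = 0} ->
  Pf (block_mx A B (- B^T) 0) = pf a (s1 ++ s2).
Proof.
move=> hp hq pq hA hB hB' h0; apply: (@Pf_pf _ _ _ x0) => //.
  by rewrite size_cat hp hq.
have nthl (i : 'I_p) : nth x0 (s1 ++ s2) (lshift q i) = nth x0 s1 i.
  by rewrite nth_cat hp /= ltn_ord.
have nthr (j : 'I_q) : nth x0 (s1 ++ s2) (rshift p j) = nth x0 s2 j.
  by rewrite nth_cat hp /= ltnNge leq_addr addKn.
move=> i j; case: (split_ordP i) => i' ->; case: (split_ordP j) => j' ->;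
  rewrite ?nthl ?nthr.
- by rewrite block_mxEul.
- by rewrite block_mxEur.
- by rewrite block_mxEdl !mxE hB' opprK.
by rewrite block_mxEdr mxE h0 ?mem_nth ?hq.
Qed.

Lemma two_mpoly n : (2 : {mpoly int[n]}) != 0.
Proof. by rewrite -mpolyC_nat mpolyC_eq0. Qed.

Definition vars n : seq {mpoly int[n]} := [seq 'X_i | i <- enum 'I_n].

Lemma qfunE n : qfun n =1 q_at (vars n).
Proof. by move=> k; rewrite /qfun /q_at big_map big_enum. Qed.

Lemma qseq_qfun n : qseq (qfun n).
Proof.
split; first by rewrite qfunE (qseq_q_at _).1.
by move=> k; under eq_bigr => i _ do rewrite !qfunE; apply: (qseq_q_at _).2.
Qed.

Lemma size_pad_odd s : odd (size (pad (odd (size s)) s)) = false.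
Proof. by rewrite /pad; case: ifP => // h; rewrite size_rcons /= h. Qed.

Lemma QfunE n la : Qfun n la = qpf (qfun n) la.
Proof.
rewrite /Qfun /qpf; set s := pad _ la.
apply: (@Pf_pf _ _ (q2 (qfun n)) 0%N) => //; first by rewrite size_pad_odd.
by move=> i j; rewrite mxE.
Qed.

Lemma Q1_qdiff n a c : Q1 n (a%:Z - c%:Z) = qdiff (qfun n) a c.
Proof.
rewrite /qdiff; case: leqP => h; first by rewrite subzn.
have -> : (a%:Z - c%:Z)%R = - (c - a)%N%:Z by rewrite -subzn ?opprB // ltnW.
by case: (c - a)%N (subn_gt0 a c) => [|k] //; rewrite h.
Qed.

Lemma QextE n al mu : Qext n al mu = qskew (qfun n) al mu.
Proof.
rewrite /Qext /qskew /bordered; set be := pad _ mu.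
have be_even : ~~ odd (size al + size be).
  by rewrite /be /pad; case: ifP => [e|->//]; rewrite size_rcons addnS /= e.
have nthl i : (i < size al)%N ->
    nth (inl 0%N) (map inl al) i = inl (nth 0%N al i) :> nat + nat.
  exact: (nth_map 0%N).
have nthr (j : 'I_(size be)) :
    nth (inl 0%N) (map inr (rev be)) j = inr (nth 0%N be (rev_ord j)) :> nat + nat.
  by rewrite (nth_map 0%N) ?size_rev // nth_rev.
apply: (@Pf_block_pf _ _ (qform (qfun n)) (inl 0%N)); rewrite ?size_map ?size_rev //.
- by move=> i j; rewrite mxE !nthl.
- by move=> i j; rewrite mxE nthl // nthr Q1_qdiff.
- by move=> i j; rewrite mxE nthl // nthr Q1_qdiff /qform /= opprK.
by move=> u v /mapP[c _ ->] /mapP[d _ ->].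
Qed.

Section Embeddings.
Variables n p : nat.

(** [in_x] and [in_y] as ring morphisms, to move them inside Pfaffians. *)
Definition in_x_rm : {rmorphism {mpoly int[n]} -> {mpoly int[n + p]}} :=
  comp_mpoly [tuple 'X_(lshift p i) | i < n].
Definition in_y_rm : {rmorphism {mpoly int[p]} -> {mpoly int[n + p]}} :=
  comp_mpoly [tuple 'X_(rshift n i) | i < p].

Lemma in_xX i : in_x_rm 'X_i = 'X_(lshift p i).
Proof. by rewrite /= comp_mpolyXU -tnth_nth tnth_mktuple. Qed.

Lemma in_yX i : in_y_rm 'X_i = 'X_(rshift n i).
Proof. by rewrite /= comp_mpolyXU -tnth_nth tnth_mktuple. Qed.

Lemma qfun_split : qfun (n + p) =1 conv (in_x_rm \o qfun n) (in_y_rm \o qfun p).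
Proof.
move=> k; transitivity (q_at (map in_x_rm (vars n) ++ map in_y_rm (vars p)) k).
  have ex N : \prod_(x <- map in_x_rm (vars n)) q_factor N x =
      \prod_(i < n) q_factor N 'X_(lshift p i).
    by rewrite /vars 2!big_map big_enum; apply: eq_bigr => i _; rewrite in_xX.
  have ey N : \prod_(x <- map in_y_rm (vars p)) q_factor N x =
      \prod_(i < p) q_factor N 'X_(rshift n i).
    by rewrite /vars 2!big_map big_enum; apply: eq_bigr => i _; rewrite in_yX.
  by rewrite /q_at big_cat /= ex ey /qfun big_split_ord.
rewrite q_at_cat; apply: eq_bigr => i _ /=.
by rewrite -!rmorph_q_at !qfunE.
Qed.

End Embeddings.

(** * The skew functions and the theorem *)

Lemma strict_partition_cons c mu : strict_partition (c :: mu) ->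
  [/\ strict_partition mu, (0 < c)%N & forall a, a \in mu -> (a < c)%N].
Proof.
case/andP => hs; rewrite inE negb_or eq_sym -lt0n => /andP[c0 mu0]; split=> //.
  by rewrite /strict_partition (path_sorted hs).
by move=> a /(allP (order_path_min gtn_trans hs)).
Qed.

Lemma subseqs_nil (T : eqType) (s : seq T) : [::] \in subseqs s.
Proof. by elim: s => //= x s IH; rewrite mem_cat IH orbT. Qed.

Lemma subseqs_downS N : subseqs (down N.+1) =
  [seq N.+1 :: t | t <- subseqs (down N)] ++ subseqs (down N).
Proof. by []. Qed.

Lemma mem_subseqs_down N mu :
  (mu \in subseqs (down N)) = strict_partition mu && all (leq^~ N) mu.
Proof.
elim: N mu => [|N IH] mu.
  case: mu => [|[|c] mu]; rewrite // inE /= ?andbF //.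
  by rewrite /strict_partition inE eqxx andbF.
rewrite subseqs_downS mem_cat; case: mu => [|c mu].
  by rewrite subseqs_nil orbT.
have -> : (c :: mu \in [seq N.+1 :: i | i <- subseqs (down N)]) =
    (c == N.+1) && (mu \in subseqs (down N)).
  apply/mapP/andP => [[t ht [-> ->]]|[/eqP-> h]]; first by rewrite eqxx.
  by exists mu.
rewrite !IH; apply/idP/idP.
  case/orP => [/andP[/eqP-> /andP[hmu hN]]|/andP[-> /= /andP[h hN]]]; last first.
    by rewrite leqW //=; apply: sub_all hN => a; apply: leqW.
  have /andP[hs h0] := hmu.
  apply/andP; split; last by rewrite /= leqnn; apply: sub_all hN => a; apply: leqW.
  rewrite /strict_partition inE negb_or h0 /= andbT.
  by case: mu hs hN {hmu h0} => //= b mu -> /andP[bN _]; rewrite ltnS bN.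
case/andP => h /=; have [hmu c0 hlt] := strict_partition_cons h.
case/andP => cN hN; rewrite h hmu /=.
have [c_eq|c_lt] := eqVneq c N.+1.
  by apply/orP; left; apply/allP => a /hlt; rewrite c_eq.
have cN' : (c <= N)%N by rewrite -ltnS ltn_neqAle c_lt.
by rewrite cN' /=; apply/allP => a /hlt /ltnW ac; apply: leq_trans ac cN'.
Qed.

Lemma uniq_subseqs_down N : uniq (subseqs (down N)).
Proof.
elim: N => // N IH; rewrite subseqs_downS cat_uniq IH andbT map_inj_uniq ?IH => [|s t []//].
apply/hasPn => t; rewrite mem_subseqs_down => /andP[_ /allP tN].
by apply/mapP => -[r _ e]; have := tN N.+1; rewrite e mem_head ltnn => /(_ isT).
Qed.

Lemma Qext_spec la : strict_partition la -> skewQ_spec la (fun mu n => Qext n la mu).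
Proof.
move=> /andP[_ la0]; pose N := \max_(a <- la) a.
have laN a : a \in la -> (a <= N)%N by move=> ha; apply: leq_bigmax_seq.
exists (subseqs (down N)); split.
- exact: uniq_subseqs_down.
- by apply/allP => mu; rewrite mem_subseqs_down => /andP[].
- move=> mu hmu; rewrite mem_subseqs_down hmu => /allPn[m hm]; rewrite -ltnNge => Nm n.
  rewrite QextE (qskew_large _ hm) // => a /laN aN.
  exact: leq_ltn_trans Nm.
move=> n p; rewrite QfunE (eq_qpf _ (@qfun_split n p)).
rewrite (@qskew_expansion _ (two_mpoly _) _ _ _ N) //; last 3 first.
- split=> [|k]; first by rewrite /= (qseq_qfun n).1 rmorph1.
  rewrite -[RHS](rmorph0 (in_x_rm n p)) -[in RHS]((qseq_qfun n).2 k) rmorph_sum.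
  by apply: eq_bigr => i _; rewrite !rmorphM rmorphXn rmorphN1.
- split=> [|k]; first by rewrite /= (qseq_qfun p).1 rmorph1.
  rewrite -[RHS](rmorph0 (in_y_rm n p)) -[in RHS]((qseq_qfun p).2 k) rmorph_sum.
  by apply: eq_bigr => i _; rewrite !rmorphM rmorphXn rmorphN1.
- split=> [|k]; first by rewrite -qfun_split (qseq_qfun _).1.
  by under eq_bigr => i _ do rewrite -!qfun_split; apply: (qseq_qfun _).2.
apply: eq_bigr => mu _; congr (_ * _).
  by rewrite -(rmorph_qskew (in_x_rm n p)) QextE.
by rewrite -(rmorph_qpf (in_y_rm n p)) QfunE.
Qed.

Lemma mpoly_int_rmorph_eq n (R : comNzRingType) (f g : {rmorphism {mpoly int[n]} -> R}) :
  (forall i, f 'X_i = g 'X_i) -> f =1 g.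
Proof.
move=> h q; rewrite (mpolyE q) !rmorph_sum; apply: eq_bigr => m _.
rewrite -mul_mpolyC !rmorphM; congr (_ * _).
  have e (k : {rmorphism {mpoly int[n]} -> R}) c : k c%:MP = c%:~R.
    by rewrite -[c in LHS]intz rmorph_int rmorph_int.
  by rewrite !e.
rewrite mpolyXE_id !rmorph_prod; apply: eq_bigr => i _.
by rewrite !rmorphXn h.
Qed.

(** The difference of two families is a linear relation between the [Qfun p nu]
    with coefficients in the ring of the variables [x], for every [p].
    Evaluating the variables [y] at arbitrary values puts it in the form
    required by [qpf_independent].  The bound [N] makes the supports of both
    families, and [mu], part of one common range of summation. *)
Lemma skewQ_spec_unique la F G : skewQ_spec la F -> skewQ_spec la G ->
  forall mu, strict_partition mu -> forall n, F mu n = G mu n.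
Proof.
move=> [s1 [u1 st1 z1 e1]] [s2 [u2 st2 z2 e2]] mu hmu n.
pose N := \max_(a <- flatten (mu :: s1 ++ s2)) a.
have hN nu : nu \in mu :: s1 ++ s2 -> strict_partition nu -> nu \in subseqs (down N).
  move=> h hnu; rewrite mem_subseqs_down hnu; apply/allP => a ha.
  by apply: leq_bigmax_seq => //; apply/flattenP; exists nu.
have sumE (V : nmodType) (f : seq nat -> V) s : uniq s -> all strict_partition s ->
    {subset s <= mu :: s1 ++ s2} ->
    (forall nu, strict_partition nu -> nu \notin s -> f nu = 0) ->
    \sum_(nu <- s) f nu = \sum_(nu <- subseqs (down N)) f nu.
  move=> us /allP hs sub hf.
  rewrite [RHS](bigID (mem s)) /= [X in _ + X]big1_seq ?addr0; last first.
    by move=> nu /andP[h1]; rewrite mem_subseqs_down => /andP[h2 _]; apply: hf.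
  rewrite -[RHS]big_filter; apply: perm_big; apply: uniq_perm => //.
    by rewrite filter_uniq // uniq_subseqs_down.
  move=> nu; rewrite mem_filter; apply/idP/andP => [h|[]//].
  by split=> //; apply: hN; [apply: sub | apply: hs].
apply/eqP; rewrite -subr_eq0; apply/eqP.
have := @qpf_independent {mpoly int[n]} (fun nu => F nu n - G nu n) N _ _ idfun
  (two_mpoly n) mu (hN _ (mem_head _ _) hmu).
apply=> R phi ys two_neq0; set p := size ys.
(* [psi] extends [phi] by the values [ys] of the variables [y]. *)
pose h (i : 'I_(n + p)) := match split i with inl j => phi 'X_j | inr j => ys`_j end.
pose psi : {rmorphism {mpoly int[n + p]} -> R} := mmap intr h.
have psiX i : psi 'X_i = h i by rewrite /psi /= mmapX mmap1U.
have psi_x f : psi (in_x_rm n p f) = phi f.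
  apply: (@mpoly_int_rmorph_eq n R (psi \o in_x_rm n p) phi) => i.
  by rewrite /= -[comp_mpoly _ _]/(in_x_rm n p 'X_i) in_xX psiX /h -[lshift p i]/(unsplit (inl i)) unsplitK.
have psi_y nu : psi (in_y_rm n p (Qfun p nu)) = qpf (q_at ys) nu.
  rewrite QfunE !rmorph_qpf; apply: eq_qpf => k.
  rewrite [LHS]/= qfunE (rmorph_q_at (in_y_rm n p)) (rmorph_q_at psi); congr (q_at _ k).
  rewrite /vars -2!map_comp -[RHS](mkseq_nth 0) /mkseq -val_enum_ord -map_comp.
  by apply: eq_map => j; rewrite [LHS]/= -[comp_mpoly _ _]/(in_y_rm n p 'X_j) in_yX psiX /h -[rshift n j]/(unsplit (inr j)) unsplitK.
have eF := e1 n p; have eG := e2 n p.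
rewrite (sumE _ _ s1) in eF => //; last 2 first.
- by move=> nu h'; rewrite inE mem_cat h' orbT.
- by move=> nu h1 h2; rewrite z1 // /in_x rmorph0 mul0r.
rewrite (sumE _ _ s2) in eG => //; last 2 first.
- by move=> nu h'; rewrite inE mem_cat h' !orbT.
- by move=> nu h1 h2; rewrite z2 // /in_x rmorph0 mul0r.
move: eF; rewrite eG => /esym/eqP; rewrite -subr_eq0 -sumrB => /eqP/(congr1 psi).
rewrite rmorph0 rmorph_sum => eFG; rewrite -[RHS]eFG; apply: eq_bigr => nu _.
rewrite -mulrBl rmorphM -[in_y _ _]/(in_y_rm n p _) psi_y; congr (_ * _).
by rewrite -[in_x _ _]/(in_x_rm n p _) -[in_x _ (G _ _)]/(in_x_rm n p _) -rmorphB psi_x.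
Qed.

Lemma skewQE la mu n : strict_partition la -> strict_partition mu ->
  skewQ la mu n = qskew (qfun n) la mu.
Proof.
move=> hla hmu; rewrite -QextE.
have spec := Qext_spec hla.
by apply: (skewQ_spec_unique (epsilon_spec _ _ (ex_intro _ _ spec)) spec).
Qed.

Lemma sorted_rcons0 mu : strict_partition mu -> sorted gtn (rcons mu 0%N).
Proof.
case: mu => // c mu /andP[/= hs mu0]; rewrite rcons_path hs /= lt0n.
by apply: contraNneq mu0 => <-; apply: mem_last.
Qed.

Theorem theorem5p3 (la mu : seq nat)
    (hla : strict_partition la) (hmu : strict_partition mu) (n : nat) :
  let l := size la in
  let m := size mu in
  let s := if odd (l + m) then m.+1 else m in
  (* (mu_1, ..., mu_s), where mu_(m+1) = 0 *)
  let mus := mkseq (nth 0%N mu) s in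
  let A := \matrix_(i < l, j < l)
             Qext n [:: nth 0%N la i, nth 0%N la j & mu] mu in
  let B := \matrix_(i < l, j < s)
             Qext n (nth 0%N la i :: omit_nth j mus) mu in
  skewQ la mu n = Pf (block_mx A B (- B^T) 0).
Proof.
move=> l m s mus A B; rewrite skewQE //.
have two := two_mpoly n; have hq := qseq_qfun n.
set a := qform (qfun n).
have a_anti := @qform_anti _ (qfun n).
have [/andP[_ la0] /andP[mu_sorted mu0]] := (hla, hmu).
have size_mus : size mus = s by rewrite size_mkseq.
have musE : mus = pad (odd (l + m)) mu.
  rewrite /mus /s /pad; case: ifP => _; last exact: mkseq_nth.
  by rewrite /mkseq -addn1 iotaD map_cat /= nth_default // -[map _ _]/(mkseq _ _) mkseq_nth cats1.
have mus_sorted : sorted gtn mus.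
  rewrite musE /pad; case: ifP => // _; exact: sorted_rcons0.
have odd_s : odd (s + m) = odd (l + m).
  by rewrite /s; case: ifP => [h|_]; rewrite ?addSn /= oddD addbb.
have size_omit (j : 'I_s) : (size (omit_nth j mus)).+1 = s.
  rewrite size_cat size_takel ?size_drop size_mus; last exact: ltnW.
  by have := ltn_ord j; lia.
pose sym (k : nat) : nat + nat := inl k.
pose star (k : nat) : nat + nat := inr k.
have -> : qskew (qfun n) la mu = pf a (map sym la ++ map star (rev mus)).
  by rewrite musE.
clearbody mus.
rewrite (@pf_dual_sylvester _ _ a two a_anti _ (map sym mus) _ _ _ _ (sym 0%N)); last 3 first.
- by move=> u v /mapP[c _ ->] /mapP[d _ ->].
- by rewrite !size_map size_rev.
- exact: qskew_diag.
rewrite size_map size_mus.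
set sylv := sylv_form _ _ _.
have nth_la (i : 'I_l) : nth (inl (sym 0%N)) (map inl (map sym la)) i =
    inl (sym (nth 0%N la i)) :> (nat + nat) + nat.
  by rewrite -map_comp (nth_map 0%N).
have nth_dual (j : 'I_s) : nth (inl (sym 0%N)) (map inr (iota 0 s)) j =
    inr (j : nat) :> (nat + nat) + nat.
  by rewrite (nth_map 0%N) ?size_iota // nth_iota.
have la_neq0 (i : 'I_l) : nth 0%N la i != 0%N.
  by apply: contraNneq la0 => <-; apply: mem_nth.
(* The final zero of [mus], if any, cancels against its own column. *)
have entryA x y : x != 0%N -> y != 0%N ->
    Qext n [:: x, y & mu] mu = sylv (inl (sym x)) (inl (sym y)).
  move=> x0 y0; rewrite QextE /qskew /= negbK oddD addbb.
  rewrite -[RHS]/(pf a (bordered [:: x, y & mus] mus)) musE {1 3}/pad.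
  case: ifP => // _; rewrite -!rcons_cons pf_bordered_pair0 //.
  by rewrite !inE !negb_or ![0%N == _]eq_sym x0 y0.
have entryB x (j : 'I_s) :
    Qext n (x :: omit_nth j mus) mu = sylv (inl (sym x)) (inr (j : nat)).
  rewrite QextE /qskew -[size (x :: _)]/(size _).+1 size_omit odd_s -musE.
  by rewrite /sylv /= -map_take -map_drop -map_cat.
apply/esym; apply: (@Pf_block_pf _ _ _ (inl (sym 0%N))); rewrite ?size_map ?size_iota //.
- by move: odd_s; rewrite !oddD => /addIb ->; rewrite addbb.
- by move=> i j; rewrite mxE !nth_la entryA.
- by move=> i j; rewrite mxE nth_la nth_dual entryB.
- by move=> i j; rewrite mxE nth_la nth_dual entryB /= opprK.
by move=> u v /mapP[c _ ->] /mapP[d _ ->].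
Qed.
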